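(* Let $\mu$ be a strongly Rayleigh probability distribution on $\{0,1\}^m$, and let $X$ be a random variable distributed according to $\mu$. Let $S_1 \sqcup \cdots \sqcup S_n = [m]$ be a partition of $[m]$, and define random variables $A_1,\ldots,A_n$ via $A_i := \sum_{s \in S_i} X_s$ for all $i \in [n]$. Let $\kappa \in \mathbb{Z}^n$ have non-negative entries and let $\epsilon > 0$. If $\left\|\mathbb{E}[A] - \kappa\right\|_1 \leq 1 - \epsilon$, where $A = (A_1,\ldots,A_n)$, then \[ \mathbb{P}[\forall i : A_i = \kappa_i] \geq \epsilon^n \prod_{i : \kappa_i > 0} \frac{1}{e\sqrt{\kappa_i}} . \] In particular, if $\kappa = \mathbf{1}$ and $\left\|\mathbb{E}[A] - \mathbf{1}\right\|_1 \leq 1 - \epsilon$, then \[ \mathbb{P}[\forall i : A_i = 1] \geq \left(\frac{\epsilon}{e}\right)^n . \]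
   Context: $[m] = \{1,\ldots,m\}$, $\mathbf{1}$ is the all-ones vector, and $\|v\|_1 = \sum_i |v_i|$. A probability distribution $\mu$ on $\{0,1\}^m$ is strongly Rayleigh if its probability generating function $p_\mu(z_1,\ldots,z_m) := \sum_{S \subseteq [m]} \mu(1_S) \prod_{i \in S} z_i$ (where $1_S$ is the indicator vector of $S$) is real stable, i.e. $p_\mu(z_1,\ldots,z_m) \neq 0$ whenever $z_1,\ldots,z_m$ all lie in the open complex upper half-plane. *)

(* Defs.v *)
From HB Require Import structures.
From mathcomp Require Export all_boot all_order all_algebra.
From mathcomp Require Export complex.
From mathcomp Require Export all_classical all_reals all_analysis.
Export Order.TTheory GRing.Theory Num.Theory.
Export numFieldNormedType.Exports.

Set Implicit Arguments.
Unset Strict Implicit.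
Unset Printing Implicit Defensive.

Local Open Scope classical_set_scope.
Local Open Scope ring_scope.

Definition indicator_tuple (m : nat) (S : {set 'I_m}) : m.-tuple bool :=
  [tuple i \in S | i < m].

Definition gen_poly (R : realType) (m : nat) (mu : probability (m.-tuple bool) R)
    (z : 'I_m -> R[i]) : R[i] :=
  \sum_(S : {set 'I_m})
    (fine (mu [set indicator_tuple S]))%:C%C * \prod_(i in S) z i.

(* The coefficients of [gen_poly mu] are real by construction, so real stability
   is just the absence of zeros with all coordinates in the open upper
   half-plane. *)
Definition strongly_Rayleigh (R : realType) (m : nat)
    (mu : probability (m.-tuple bool) R) : Prop :=
  forall z : 'I_m -> R[i],
    (forall i, 0 < complex.Im (z i)) -> gen_poly mu z != 0.

(* Parts may be empty, so the family of [n] parts need not be injective. *)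
Definition indexed_partition (m n : nat) (S : 'I_n -> {set 'I_m}) : Prop :=
  (forall i j, i != j -> [disjoint S i & S j]%B) /\
  (\bigcup_(i < n) S i)%SET = [set: 'I_m]%SET.

Definition block_sum (R : realType) (T : Type) (m : nat) (X : T -> m.-tuple bool)
    (B : {set 'I_m}) (t : T) : R :=
  \sum_(s in B) (tnth (X t) s)%:R.

(* Main.v *)
Require Import Defs.
From mathcomp Require Import ring lra measurable_realfun.

(** Let p be the generating polynomial of A.  Two facts are combined.

    Capacity: p(x) >= eps^n x^kappa for all x > 0.  Raise the coordinates of x
    above 1, one level set T at a time, from min(x, u) to min(x, u').  Along such a
    step p is real-rooted, so its growth is that of a sum of independent Bernoulli
    variables with mean E_y[A_T], where E_y is the law tilted by y = min(x, u).
    This mean is at least the untilted one, hence at least kappa(T) - 1 + eps, and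
    the step loses a factor at most eps against x^kappa.  The comparison of means
    uses that lowering other coordinates increases a marginal (negative
    dependence), and that scaling a set of coordinates by t, while the remaining
    ones move affinely with nonnegative coefficients, increases the marginals of
    that set.  Both follow from the Hermite-Biehler sign of A B' - A' B for real
    polynomials with A + i B free of zeros in the upper half-plane.  Coordinates
    below 1 are lowered in the same way.

    Coefficients (Gurvits): if p(x) >= M x^kappa on the positive orthant then the
    coefficient of x^kappa is at least M times the product of the numbers
    kappa_i^kappa_i e^-kappa_i / kappa_i!; differentiate once at a time, using that
    log p is dominated by its tangent in each direction.  Stirling's bound
    concludes. *)

Set Implicit Arguments.
Unset Strict Implicit.
Unset Printing Implicit Defensive.

Local Open Scope ring_scope.

(** * Multi-affine polynomials indexed by sets of variables *)

Lemma sum_setU1 (I : finType) (V : nmodType) (s : I) (F : {set I} -> V) :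
  \sum_(S : {set I} | s \in S) F S = \sum_(S : {set I} | s \notin S) F (s |: S).
Proof.
rewrite (reindex_onto (fun S => s |: S) (fun S => S :\ s)) /=; last first.
  by move=> S sS; rewrite finset.setD1K.
apply: eq_bigl => S; rewrite finset.setU11 /=; apply/eqP/idP => [<-|sS].
  by rewrite finset.setD11.
by rewrite finset.setU1K.
Qed.

Section MultiAffine.
Variables (K : comNzRingType) (m : nat).
Implicit Types (c : {set 'I_m} -> K) (z : 'I_m -> K) (S T : {set 'I_m}).

Definition mev c z : K := \sum_S c S * \prod_(i in S) z i.

(* Coefficients of the partial derivative in the variable [s]. *)
Definition pdel (s : 'I_m) c S : K := if s \in S then 0 else c (s |: S).

Definition pres (s : 'I_m) c S : K := if s \in S then 0 else c S.

Lemma eq_mev c z z' : z =1 z' -> mev c z = mev c z'.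
Proof.
by move=> e; apply: eq_bigr => S _; congr (_ * _); apply: eq_bigr => i _.
Qed.

Lemma mev_split s c z : mev c z = mev (pres s c) z + z s * mev (pdel s c) z.
Proof.
rewrite /mev (bigID (fun S : {set 'I_m} => s \in S)) /= addrC; congr (_ + _).
  rewrite [RHS](bigID (fun S : {set 'I_m} => s \in S)) /=.
  rewrite [X in _ = X + _]big1 ?add0r; last by move=> S sS; rewrite /pres sS mul0r.
  by apply: eq_bigr => S /negbTE sS; rewrite /pres sS.
rewrite [in RHS](bigID (fun S : {set 'I_m} => s \in S)) /=.
rewrite [X in _ = _ * (X + _)]big1 ?add0r; last first.
  by move=> S sS; rewrite /pdel sS mul0r.
rewrite sum_setU1 mulr_sumr; apply: eq_bigr => S sS.
by rewrite /pdel (negbTE sS) big_setU1 //= mulrCA.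
Qed.

Lemma eq_mev_off s c z z' : (forall S, s \in S -> c S = 0) ->
  (forall i, i != s -> z i = z' i) -> mev c z = mev c z'.
Proof.
move=> c0 e; apply: eq_bigr => S _.
have [sS|sS] := boolP (s \in S); first by rewrite c0 ?mul0r.
congr (_ * _); apply: eq_bigr => i iS; apply: e.
by apply: contraNneq sS => <-.
Qed.

Lemma pres_off s c S : s \in S -> pres s c S = 0.
Proof. by rewrite /pres => ->. Qed.

Lemma pdel_off s c S : s \in S -> pdel s c S = 0.
Proof. by rewrite /pdel => ->. Qed.

(** The polynomial is affine in [z s], so the first-order expansion is exact. With increment ['i] it
    presents a shift of one variable as [A + 'i * B], [B] being a partial derivative. *)
Lemma mev_upd s c z z' : (forall i, i != s -> z' i = z i) ->
  mev c z' = mev c z + (z' s - z s) * mev (pdel s c) z.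
Proof.
move=> e; rewrite (mev_split s c z') (mev_split s c z).
rewrite (eq_mev_off (@pres_off s c) e) (eq_mev_off (@pdel_off s c) e).
by ring.
Qed.

(** Derivative along the indicator vector of [T], that is, in the common variable once the variables
    in [T] are identified. *)
Definition psum T c S : K := \sum_(i in T) pdel i c S.

Lemma mev_psum T c z : mev (psum T c) z = \sum_(i in T) mev (pdel i c) z.
Proof.
rewrite /mev exchange_big /=; apply: eq_bigr => S _.
by rewrite /psum mulr_suml.
Qed.

Lemma mev_add c c' z : mev (fun S => c S + c' S) z = mev c z + mev c' z.
Proof. by rewrite /mev -big_split; apply: eq_bigr => S _; rewrite mulrDl. Qed.

Lemma mev_scale a c z : mev (fun S => a * c S) z = a * mev c z.
Proof. by rewrite /mev mulr_sumr; apply: eq_bigr => S _; rewrite mulrA. Qed.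

(** Substituting univariate polynomials for the variables, mostly along lines, gives access to roots
    and derivatives in one variable. *)
Definition pmev c (z : 'I_m -> {poly K}) : {poly K} :=
  \sum_S c S *: \prod_(i in S) z i.

Lemma horner_pmev c (z : 'I_m -> {poly K}) t :
  (pmev c z).[t] = mev c (fun i => (z i).[t]).
Proof.
rewrite /pmev /mev horner_sum; apply: eq_bigr => S _.
by rewrite hornerZ horner_prod.
Qed.

Lemma deriv_prod_seq (r : seq 'I_m) (z : 'I_m -> {poly K}) : uniq r ->
  (\prod_(i <- r) z i)^`() =
  \sum_(i <- r) (z i)^`() * \prod_(j <- r | j != i) z j.
Proof.
elim: r => [|a r IH] /=; first by rewrite !big_nil derivC.
case/andP=> ar ur; rewrite !big_cons derivM IH // eqxx /=; congr (_ + _).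
  congr (_ * _); rewrite [in RHS]big_seq_cond [LHS]big_seq_cond.
  apply: eq_bigl => i; rewrite andbT.
  by case: (boolP (i \in r)) => //= ir; apply/esym; apply: contraNneq ar => <-.
rewrite mulr_sumr big_seq [RHS]big_seq; apply: eq_bigr => i ir.
rewrite big_cons ifT; first by rewrite mulrCA.
by apply: contraNneq ar => ->.
Qed.

Lemma deriv_pmev c (z : 'I_m -> {poly K}) :
  (pmev c z)^`() = \sum_s (z s)^`() * pmev (pdel s c) z.
Proof.
pose G s S := c S *: ((z s)^`() * \prod_(j in S :\ s) z j).
have E S : (c S *: \prod_(i in S) z i)^`() = \sum_(s in S) G s S.
  rewrite derivZ -big_enum /= deriv_prod_seq ?enum_uniq // scaler_sumr.
  rewrite big_enum /=; apply: eq_bigr => s sS; rewrite /G; congr (_ *: (_ * _)).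
  rewrite big_enum_cond /=; apply: eq_bigl => j.
  by rewrite !inE andbC.
rewrite /pmev raddf_sum /= (eq_bigr _ (fun S _ => E S)).
rewrite (exchange_big_dep predT) //=; apply: eq_bigr => s _.
rewrite [in RHS](bigID (fun S : {set 'I_m} => s \in S)) /=.
rewrite [X in _ = _ * (X + _)]big1 ?add0r; last first.
  by move=> S sS; rewrite /pdel sS scale0r.
rewrite sum_setU1 mulr_sumr; apply: eq_bigr => S sS.
by rewrite /G finset.setU1K // /pdel (negbTE sS) -scalerAr.
Qed.

(** This degree bound makes the constant in [stable_growth] the same for all polynomials, as passing
    to a limit requires. *)
Lemma size_pmev c (z : 'I_m -> {poly K}) : (forall i, (size (z i) <= 2)%N) ->
  (size (pmev c z) <= m.+1)%N.
Proof.
move=> hz; apply: (leq_trans (size_sum _ _ _)); apply/bigmax_leqP => S _.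
apply: (leq_trans (size_scale_leq _ _)).
apply: (@leq_trans #|S|.+1); last first.
  by rewrite ltnS -[X in (_ <= X)%N](card_ord m) max_card.
rewrite -sum1_card.
elim/big_rec2: _ => [|i k p iS IH]; first by rewrite size_poly1.
apply: (leq_trans (size_polyMleq _ _)).
rewrite -subn1 leq_subLR add1n.
exact: (leq_trans (leq_add (hz i) IH)).
Qed.

End MultiAffine.

(** * Growth away from roots, and vanishing in the limit *)

Section Bounds.
Variable C : numClosedFieldType.
Implicit Types (p q : {poly C}).

Lemma poly_bound_disc p :
  exists2 B, 0 <= B & forall t, `|t| <= 1 -> `|p.[t]| <= B.
Proof.
exists (\sum_(i < size p) `|p`_i|); first exact: sumr_ge0.
move=> t t1; rewrite horner_coef (le_trans (ler_norm_sum _ _ _)) //.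
apply: ler_sum => i _; rewrite normrM normrX ler_piMr //.
exact: exprn_ile1.
Qed.

(* Hurwitz' theorem in quantitative form: the bound survives limits of
   polynomials of bounded degree, so a limit vanishing at [w] vanishes
   identically. *)
Lemma growth_off_roots q w u rho : 0 < rho ->
  (forall v, `|v - w| < rho -> q.[v] != 0) ->
  `|q.[w + u]| <= `|q.[w]| * (1 + `|u| / rho) ^+ (size q).-1.
Proof.
move=> rho0 hq; have [r qE] := closed_field_poly_normal q.
have q0 : q != 0.
  apply: contraNneq (hq w _) => [->|]; first by rewrite horner0.
  by rewrite subrr normr0.
have lq : lead_coef q != 0 by rewrite lead_coef_eq0.
have -> : (size q).-1 = size r.
  by rewrite qE size_scale // size_prod_XsubC.
(* Every root [x] is at distance at least [rho] from [w], so
   [|w + u - x| <= |w - x| * (1 + |u| / rho)]; these bounds are multiplied over the roots. *)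
have hr x : x \in r -> rho <= `|w - x|.
  move=> xr; rewrite real_leNgt ?num_real //; last exact: gtr0_real.
  apply/negP; rewrite distrC => /hq; rewrite qE hornerZ mulf_eq0 (negbTE lq) /=.
  by rewrite -/(root _ _) root_prod_XsubC xr.
rewrite qE !hornerZ !normrM -mulrA ler_wpM2l //.
elim: r {qE} hr => [_|a r IH hr]; first by rewrite !big_nil !hornerC expr0 mulr1.
rewrite !big_cons !hornerM !normrM exprS mulrACA ler_pM //.
- rewrite !hornerXsubC addrAC (le_trans (ler_normD _ _)) // mulrDr mulr1 lerD2l.
  rewrite mulrCA ler_peMr // ler_pdivlMr // mul1r hr //.
  by rewrite inE eqxx.
- by apply: IH => x xr; apply: hr; rewrite inE xr orbT.
Qed.

(** Writing [f.[t] = f.[0] + t * g.[t]] with [g] bounded on the unit disc turns the hypothesis into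
    [|p.[0]| <= d * M] for all small [d]. *)
Lemma limit_vanish p q (K : C) : 0 <= K ->
  (forall d, 0 < d -> d <= 1 -> `|p.[d]| <= K * `|q.[d]|) ->
  q.[0] = 0 -> p.[0] = 0.
Proof.
move=> K0 h q0.
have split0 (f : {poly C}) : exists g, forall t, f.[t] = f.[0] + t * g.[t].
  have /factor_theorem [g /= gE] : root (f - f.[0]%:P) 0.
    by rewrite /root hornerD hornerN hornerC subrr.
  exists g => t; have := congr1 (fun k => k.[t]) gE => /=.
  rewrite hornerD hornerN hornerC hornerM hornerXsubC subr0 => /eqP.
  by rewrite subr_eq addrC mulrC => /eqP.
have [p1 p1E] := split0 p; have [q1 q1E] := split0 q.
have [B B0 hB] := poly_bound_disc p1; have [D D0 hD] := poly_bound_disc q1.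
apply/eqP; rewrite -normr_eq0; apply/negPn/negP => n0.
have n1 : 0 < `|p.[0]| by rewrite lt_neqAle eq_sym n0 normr_ge0.
pose M := K * D + B.
have M0 : 0 <= M by rewrite addr_ge0 ?mulr_ge0.
have key d : 0 < d -> d <= 1 -> `|p.[0]| <= d * M.
  move=> d0 d1; have nd : `|d| <= 1 by rewrite gtr0_norm.
  have -> : p.[0] = p.[d] - d * p1.[d] by rewrite (p1E d) addrK.
  rewrite (le_trans (ler_normB _ _)) // mulrDr lerD //.
    rewrite (le_trans (h _ d0 d1)) // mulrCA ler_wpM2l //.
    by rewrite (q1E d) q0 add0r normrM gtr0_norm // ler_wpM2l ?hD // ltW.
  by rewrite normrM gtr0_norm // ler_wpM2l ?hB // ltW.
pose e := `|p.[0]|.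
have e0 : 0 <= e by exact: ltW.
have X0 : 0 < 1 + e + M by rewrite -addrA ltr_pwDl // addr_ge0.
(* At [d = e / (1 + e + M)] the bound [d * M] is strictly below [e]. *)
have d1 : e / (1 + e + M) <= 1.
  by rewrite ler_pdivrMr // mul1r addrAC lerDr addr_ge0.
have := key _ (divr_gt0 n1 X0) d1; rewrite mulrAC ler_pdivlMr // -/e.
rewrite ler_pM2l // gerDr => h1.
have : 0 < 1 + e by rewrite ltr_pwDl.
by move=> /(le_lt_trans h1); rewrite ltxx.
Qed.
End Bounds.

(** * Logarithmic derivatives, the Hermite-Biehler sign and real-rootedness *)

Section Jacobian.
Variable R : rcfType.
Local Notation C := R[i].
Local Notation Re := (@complex.Re R).
Local Notation Im := (@complex.Im R).
Implicit Types (f g : {poly C}) (A B : {poly R}).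

Let sq (z : C) : R := Re z ^+ 2 + Im z ^+ 2.

(* [`|f|^2] times the imaginary part of the logarithmic derivative of [f]. *)
Definition dlogIm f (t : C) : R := Im (f^`().[t] * (f.[t])^*%C).

Lemma dlogImM f g t :
  dlogIm (f * g) t = dlogIm f t * sq g.[t] + sq f.[t] * dlogIm g t.
Proof.
rewrite /dlogIm derivM hornerD !hornerM /sq.
case: (f.[t]) => a b; case: (g.[t]) => c d.
by case: (f^`().[t]) => a' b'; case: (g^`().[t]) => c' d' /=; simpc => /=; ring.
Qed.

Lemma dlogImZ (a : C) f t : dlogIm (a *: f) t = sq a * dlogIm f t.
Proof.
rewrite /dlogIm derivZ !hornerZ /sq; case: a => a b.
by case: (f.[t]) => c d; case: (f^`().[t]) => c' d' /=; simpc => /=; ring.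
Qed.

Lemma dlogImXsubC (w t : C) : dlogIm ('X - w%:P) t = Im w - Im t.
Proof.
rewrite /dlogIm derivXsubC hornerXsubC hornerC; case: w => a b; case: t => c d /=.
by simpc => /=; ring.
Qed.

Lemma sq_ge0 z : 0 <= sq z. Proof. by rewrite addr_ge0 ?sqr_ge0. Qed.

Lemma sq_gt0 z : z != 0 -> 0 < sq z.
Proof.
move=> z0; rewrite lt_neqAle sq_ge0 andbT eq_sym /sq paddr_eq0 ?sqr_ge0 //.
by rewrite !sqrf_eq0; move: z0; rewrite eq_complex /=.
Qed.

(** Each linear factor with root [w] contributes [Im w - Im t], weighted by the squared moduli of
    the other factors. *)
Lemma dlogIm_le0 f t : (forall w, root f w -> Im w <= Im t) -> dlogIm f t <= 0.
Proof.
have [r fE] := closed_field_poly_normal f.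
have [->|f0 hr] := eqVneq f 0; first by rewrite /dlogIm deriv0 horner0 mul0r.
have {}hr w : w \in r -> Im w <= Im t.
  move=> wr; apply: hr; rewrite fE rootZ ?lead_coef_eq0 //.
  by rewrite root_prod_XsubC.
rewrite fE dlogImZ; apply: mulr_ge0_le0; first exact: sq_ge0.
elim: r {fE} hr => [_|a r IH hr].
  by rewrite big_nil /dlogIm derivC horner0 mul0r.
rewrite big_cons dlogImM dlogImXsubC; apply: ler_wnDl.
  apply: mulr_le0_ge0; last exact: sq_ge0.
  by rewrite subr_le0 hr // inE eqxx.
apply: mulr_ge0_le0; first exact: sq_ge0.
by apply: IH => w wr; apply: hr; rewrite inE wr orbT.
Qed.

(** A single linear factor already gives a strictly negative term, since the other factors do not
    vanish at [t]. *)
Lemma dlogIm_lt0 f t : (forall w, root f w -> Im w < Im t) ->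
  (1 < size f)%N -> dlogIm f t < 0.
Proof.
move=> hr sf; have [r fE] := closed_field_poly_normal f.
have f0 : f != 0 by rewrite -size_poly_gt0 ltnW.
have lf : lead_coef f != 0 by rewrite lead_coef_eq0.
have {}hr w : w \in r -> Im w < Im t.
  by move=> wr; apply: hr; rewrite fE rootZ // root_prod_XsubC.
move: sf; rewrite fE size_scale // size_prod_XsubC ltnS dlogImZ.
rewrite pmulr_rlt0 ?sq_gt0 //.
case: r {fE} hr => [//|a r] hr _.
rewrite big_cons dlogImM dlogImXsubC; apply: ltr_wnDr; last first.
  rewrite nmulr_rlt0; last by rewrite subr_lt0 hr // inE eqxx.
  apply: sq_gt0; rewrite -/(root _ _) root_prod_XsubC.
  by apply/negP => tr; have := hr t; rewrite inE tr orbT ltxx => /(_ isT).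
apply: mulr_ge0_le0; first exact: sq_ge0.
apply: dlogIm_le0 => w; rewrite root_prod_XsubC => wr.
by apply/ltW/hr; rewrite inE wr orbT.
Qed.

Definition toC A : {poly C} := map_poly (real_complex R) A.

Lemma horner_toC A (x : R) : (toC A).[x%:C%C] = (A.[x])%:C%C.
Proof. exact: horner_map. Qed.

(** At a real point the expression is [dlogIm] of [A + 'i B], whose roots all lie in the closed
    lower half-plane. *)
Lemma hermite_biehler A B :
  (forall w, 0 < Im w -> (toC A).[w] + 'i%C * (toC B).[w] != 0) ->
  forall t, A.[t] * B^`().[t] - A^`().[t] * B.[t] <= 0.
Proof.
move=> h t; pose P := toC A + 'i%C *: toC B.
have : dlogIm P t%:C%C <= 0.
  apply: dlogIm_le0 => w; rewrite leNgt; apply: contraTN => w0.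
  by rewrite /root hornerD hornerZ; exact: h.
rewrite /dlogIm derivD derivZ !hornerD !hornerZ /toC !deriv_map.
rewrite -!/(toC _) !horner_toC /=; simpc => /=.
by apply: le_trans; rewrite le_eqVlt; apply/orP; left; apply/eqP; ring.
Qed.

(** The roots are closed under conjugation and avoid the upper half-plane, so they are real;
    positivity of [A] on the positive axis makes them nonpositive. *)
Lemma real_rooted A : (forall t, 0 < t -> 0 < A.[t]) ->
  (forall w, 0 < Im w -> (toC A).[w] != 0) ->
  exists2 r : seq R, all (>= 0) r &
    A = lead_coef A *: \prod_(x <- r) ('X + x%:P).
Proof.
move=> Apos h; have [r AE] := closed_field_poly_normal (toC A).
have A0 : A != 0.
  by apply: contraTneq (Apos 1 ltr01) => ->; rewrite horner0 ltxx.
have lA : lead_coef (toC A) = (lead_coef A)%:C%C by rewrite lead_coef_map.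
have l0 : lead_coef (toC A) != 0 by rewrite lead_coef_eq0 map_poly_eq0.
have rr w : w \in r -> root (toC A) w.
  by move=> wr; rewrite AE rootZ // root_prod_XsubC.
have rootJ w : root (toC A) w -> root (toC A) w^*%C.
  move=> rw; have <- : map_poly conjc (toC A) = toC A.
    by rewrite /toC -map_poly_comp; apply: eq_map_poly => x /=; rewrite oppr0.
  by rewrite complex_root_conj conjcK.
have rle w : root (toC A) w -> Im w <= 0.
  by rewrite leNgt; apply: contraTN => /h.
have rE w : w \in r -> w = (Re w)%:C%C /\ Re w <= 0.
  move=> wr; have i0 : Im w = 0.
    have := rle _ (rr _ wr); have := rle _ (rootJ _ (rr _ wr)).
    by case: (w) => a b /=; rewrite oppr_le0 => b0 b1; apply/eqP; rewrite eq_le b1.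
  have wE : w = (Re w)%:C%C by case: (w) i0 => a b /= ->.
  split=> //; rewrite leNgt; apply/negP => /Apos.
  have := rr _ wr; rewrite wE /root horner_toC => /eqP [] -> /=.
  by rewrite ltxx.
exists [seq - Re w | w <- r].
  by apply/allP => x /mapP [w wr ->]; rewrite oppr_ge0; case: (rE w wr).
apply: (map_poly_inj (real_complex R)); rewrite -/(toC A) AE lA.
rewrite map_polyZ; congr (_ *: _).
rewrite rmorph_prod /= big_map !big_seq; apply: eq_bigr => w wr.
have [wE _] := rE w wr.
by rewrite rmorphD /= map_polyX map_polyC /= {1}wE !rmorphN.
Qed.

End Jacobian.

(** * Stable polynomials: boundary points, derivatives and block restrictions *)

Section Stable.
Variables (R : rcfType) (m : nat).
Local Notation C := R[i].
Local Notation Re := (@complex.Re R).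
Local Notation Im := (@complex.Im R).
Implicit Types (c : {set 'I_m} -> R) (y b e : 'I_m -> R) (z : 'I_m -> C).
Implicit Types (T S : {set 'I_m}).

Definition cmev c z : C := mev (fun S => (c S)%:C%C) z.

Definition stable c : Prop :=
  forall z, (forall i, 0 < Im (z i)) -> cmev c z != 0.

Definition nonneg c : Prop := forall S, 0 <= c S.

Lemma cmev_real c y : cmev c (fun i => (y i)%:C%C) = (mev c y)%:C%C.
Proof.
rewrite /cmev /mev rmorph_sum; apply: eq_bigr => S _.
by rewrite rmorphM rmorph_prod.
Qed.

Lemma cmev_pdel s c z :
  cmev (pdel s c) z = mev (pdel s (fun S => (c S)%:C%C)) z.
Proof.
apply: eq_bigr => S _; congr (_ * _).
by rewrite /pdel; case: ifP.
Qed.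

Lemma horner_toC_pmev c b e w :
  (toC (pmev c (fun j => (b j)%:P + e j *: 'X))).[w] =
  cmev c (fun j => (b j)%:C%C + (e j)%:C%C * w).
Proof.
rewrite /toC /pmev rmorph_sum /= horner_sum; apply: eq_bigr => S _.
rewrite map_polyZ hornerZ rmorph_prod horner_prod; congr (_ * _).
apply: eq_bigr => i _.
by rewrite rmorphD /= map_polyC map_polyZ map_polyX /= !hornerE.
Qed.

Lemma mev_gt0 c y S0 : nonneg c -> c S0 != 0 -> (forall i, 0 < y i) -> 0 < mev c y.
Proof.
move=> nc c0 y0; rewrite /mev (bigD1 S0) //= ltr_pwDl //.
  apply: mulr_gt0; last by apply: prodr_gt0.
  by rewrite lt_neqAle eq_sym c0 nc.
by rewrite sumr_ge0 // => S _; rewrite mulr_ge0 // prodr_ge0 // => i _; apply/ltW.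
Qed.

Lemma mev_ge0 c y : nonneg c -> (forall i, 0 <= y i) -> 0 <= mev c y.
Proof.
by move=> nc y0; rewrite sumr_ge0 // => S _; rewrite mulr_ge0 // prodr_ge0.
Qed.

Lemma nonneg_pdel s c : nonneg c -> nonneg (pdel s c).
Proof. by move=> nc S; rewrite /pdel; case: ifP. Qed.

Lemma nonneg_psum T c : nonneg c -> nonneg (psum T c).
Proof. by move=> nc S; rewrite sumr_ge0 // => s _; exact: nonneg_pdel. Qed.

Lemma stable_neq0 c : stable c -> exists S, c S != 0.
Proof.
move=> sc; apply/existsP; rewrite -negb_forall; apply/negP => /forallP c0.
have /negP := sc (fun=> 'i%C) (fun=> ltr01); apply.
by rewrite /cmev /mev big1 // => S _; rewrite (eqP (c0 S)) mul0r.
Qed.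

Lemma stable_gt0 c y :
  nonneg c -> stable c -> (forall i, 0 < y i) -> 0 < mev c y.
Proof. by move=> nc /stable_neq0 [S]; exact: mev_gt0. Qed.

Lemma normr_Im_lt (z : C) (r : R) : `|z| < r%:C%C -> `|Im z| < r.
Proof.
rewrite normc_def ltcR; apply: le_lt_trans.
by rewrite -sqrtr_sqr ler_wsqrtr // lerDr sqr_ge0.
Qed.

(* Moving along the segment from [z] to the positive point [Re z + r Im z]
   keeps the imaginary parts positive on a disc whose radius depends only on
   [r]. *)
Lemma stable_growth z :
  (forall j, 0 <= Im (z j)) -> (forall j, Im (z j) = 0 -> 0 < Re (z j)) ->
  exists (y : 'I_m -> R) (K : C), [/\ forall j, 0 < y j, 0 <= K &
    forall c d, stable c -> (forall j, 0 < Im (z j + d * 'i%C)) ->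
      0 <= d ->
      `|cmev c (fun j => (y j)%:C%C + d * 'i%C)| <=
      K * `|cmev c (fun j => z j + d * 'i%C)| ].
Proof.
(* If [Im (z j) > 0], then [r * Im (z j) >= Im (z j) + |Re (z j)|], which makes [y j] positive.
   Terms with [Im (z j) = 0] vanish, division by 0 being 0, and there [y j = Re (z j)]. *)
move=> z0 zr; pose r : R := 1 + \sum_j `|Re (z j)| / Im (z j).
pose y j := Re (z j) + r * Im (z j).
have y0 j : 0 < y j.
  have [/zr x0|i0] := eqVneq (Im (z j)) 0.
    rewrite /y ltr_pwDl // mulr_ge0 ?z0 // /r addr_ge0 // sumr_ge0 // => k _.
    by rewrite divr_ge0.
  have ip : 0 < Im (z j) by rewrite lt_neqAle eq_sym i0 z0.
  have : 1 + `|Re (z j)| / Im (z j) <= r.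
    rewrite /r lerD2l (bigD1 j) //= lerDl sumr_ge0 // => k _.
    by rewrite divr_ge0.
  rewrite -(ler_pM2r ip) mulrDl mul1r divfK // => h.
  have : 0 < Re (z j) + (Im (z j) + `|Re (z j)|).
    by rewrite addrCA ltr_pwDl // -lerBlDl sub0r -normrN ler_norm.
  by move=> h'; rewrite (lt_le_trans h') // lerD2l.
(* Since [z j + Im (z j) * a = y j], the path below runs from [z] at [u = 0] to [y] at [u = 1], up
   to the shift [d * 'i]. For [|u| < 1 / |a|] one has [|Im (a * u)| < 1], so the imaginary parts
   stay positive. *)
pose a : C := r%:C%C - 'i%C.
have a0 : 0 < `|a|.
  rewrite normr_gt0 /a eq_complex /= negb_and; apply/orP; right.
  by simpc; rewrite oppr_eq0 oner_eq0.
exists y, ((1 + `|a|) ^+ m); split=> //.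
move=> c d sc dz d0.
pose q := pmev (fun S => (c S)%:C%C)
  (fun j => (z j + d * 'i%C)%:P + ((Im (z j))%:C%C * a) *: 'X).
have qE u : q.[u] = cmev c (fun j => z j + d * 'i%C + (Im (z j))%:C%C * a * u).
  by rewrite horner_pmev; apply: eq_mev => j; rewrite !hornerE.
have q0 v : `|v - 0| < `|a|^-1 -> q.[v] != 0.
  rewrite subr0 => vlt; rewrite qE; apply: sc => j.
  have : `|a * v| < 1%:C%C by rewrite normrM -ltr_pdivlMl // mulr1.
  move/normr_Im_lt; rewrite ltr_norml => /andP [h _].
  have -> : Im (z j + d * 'i%C + (Im (z j))%:C%C * a * v) =
            Im (z j + d * 'i%C) + Im (z j) * Im (a * v).
    case: (z j) => x1 x2; rewrite -mulrA.
    case: (a * v) => a1 a2; case: (d) => d1 d2 /=; simpc => /=; ring.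
  have := z0 j; rewrite le_eqVlt => /predU1P [<-|ip].
    by rewrite mul0r addr0.
  have E : Im (z j + d * 'i%C) = Im (z j) + Re d.
    by case: (z j) => x1 x2; case: (d) => d1 d2 /=; simpc.
  have dr : 0 <= Re d by move: d0; rewrite lecE => /andP [].
  have : 0 < Im (z j) * (1 + Im (a * v)) by rewrite mulr_gt0 // -ltrBlDl sub0r.
  rewrite E mulrDr mulr1 => h'; rewrite addrAC.
  by rewrite ltr_pwDl.
have := @growth_off_roots _ q 0 1 _ _ q0; rewrite invr_gt0 => /(_ a0).
rewrite add0r normr1 invrK mul1r !qE.
have -> : cmev c (fun j => z j + d * 'i%C + (Im (z j))%:C%C * a * 1) =
    cmev c (fun j => (y j)%:C%C + d * 'i%C).
  apply: eq_mev => j; rewrite /y /a; case: (z j) => x1 x2; case: (d) => d1 d2 /=.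
  by simpc; congr (_ +i* _)%C; ring.
have -> : cmev c (fun j => z j + d * 'i%C + (Im (z j))%:C%C * a * 0) =
    cmev c (fun j => z j + d * 'i%C).
  by apply: eq_mev => j; rewrite mulr0 addr0.
move/le_trans; apply; rewrite mulrC ler_wpM2r //.
apply: ler_weXn2l; first by rewrite lerDl.
rewrite -subn1 leq_subLR add1n size_pmev // => j.
rewrite (leq_trans (size_polyD _ _)) // geq_max size_polyC.
by rewrite (leq_trans (leq_b1 _)) //= (leq_trans (size_scale_leq _ _)) ?size_polyX.
Qed.

(** Shift all variables by [d * 'i] and let [d] tend to 0: by [stable_growth] a zero at [z] would
    force a zero at a positive real point. *)
Lemma stable_closed c z : nonneg c -> stable c ->
  (forall j, 0 <= Im (z j)) -> (forall j, Im (z j) = 0 -> 0 < Re (z j)) ->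
  cmev c z != 0.
Proof.
move=> nc sc z0 zr; apply/eqP => cz0.
have [y [K [y0 K0 h]]] := stable_growth z0 zr.
pose lift (x : 'I_m -> C) := pmev (fun S => (c S)%:C%C)
  (fun j => (x j)%:P + 'i%C *: 'X).
have liftE x d : (lift x).[d] = cmev c (fun j => x j + d * 'i%C).
  by rewrite horner_pmev; apply: eq_mev => j; rewrite !hornerE mulrC.
have : (lift (fun j => (y j)%:C%C)).[0] = 0.
  apply: (@limit_vanish _ _ (lift z) K) => // [d d0 _|].
    rewrite !liftE; apply: h => //; last exact: ltW.
    move: d0; rewrite ltcE => /andP [_ d0] j; have := z0 j.
    by case: (z j) => x1 x2; case: (d) d0 => d1 d2 /=; simpc => *; exact: ltr_wpDl.
  by rewrite liftE -[RHS]cz0; apply: eq_mev => j; rewrite mul0r addr0.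
rewrite liftE (_ : cmev _ _ = (mev c y)%:C%C).
  by case=> my; have := stable_gt0 nc sc y0; rewrite my ltxx.
by rewrite -cmev_real; apply: eq_mev => j; rewrite mul0r addr0.
Qed.

Lemma cmev_psum T c z : cmev (psum T c) z = \sum_(i in T) cmev (pdel i c) z.
Proof.
rewrite /cmev /mev exchange_big /=; apply: eq_bigr => S _.
by rewrite /psum rmorph_sum mulr_suml.
Qed.

(** Along [z + t 1_T] the polynomial [f] has all roots strictly below the real axis, so [f' / f] at
    0 has negative imaginary part, or is 0 when [f] is constant. It is never the real number
    [- d]. *)
Lemma stable_add_psum T c (d : R) : stable c -> 0 < d ->
  stable (fun S => d * c S + psum T c S).
Proof.
move=> sc d0 z z0.
have -> : cmev (fun S => d * c S + psum T c S) z =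
    d%:C%C * cmev c z + cmev (psum T c) z.
  rewrite /cmev -mev_scale -mev_add; apply: eq_bigr => S _.
  by rewrite rmorphD rmorphM.
pose f := pmev (fun S => (c S)%:C%C)
  (fun j => (z j)%:P + (j \in T)%:R *: 'X).
have f0 : f.[0] = cmev c z.
  by rewrite horner_pmev; apply: eq_mev => j; rewrite !hornerE.
have f1 : f^`().[0] = cmev (psum T c) z.
  rewrite deriv_pmev horner_sum cmev_psum [RHS]big_mkcond /=.
  apply: eq_bigr => s _; rewrite derivD derivC add0r derivZ derivX.
  rewrite hornerM hornerZ hornerC mulr1 horner_pmev cmev_pdel.
  have -> : mev (pdel s (fun S => (c S)%:C%C))
      (fun i => ((z i)%:P + (i \in T)%:R *: 'X).[0]) =
      mev (pdel s (fun S => (c S)%:C%C)) z.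
    by apply: eq_mev => j; rewrite !hornerE.
  by case: (s \in T); rewrite ?mul1r ?mul0r.
have fr w : root f w -> Im w < Im 0.
  rewrite ltNge; apply: contraTN => w0; rewrite /root horner_pmev; apply: sc => j.
  rewrite !hornerE; case: (j \in T); last by rewrite mul0r addr0.
  rewrite mul1r; have := z0 j; case: (z j) => x1 x2.
  by case: (w) w0 => w1 w2 /= ? ?; simpc; exact: ltr_pwDl.
rewrite -f0 -f1; apply/eqP => H.
have fn0 : f.[0] != 0 by rewrite f0 sc.
have f1E : f^`().[0] = - d%:C%C * f.[0].
  by apply/eqP; rewrite mulNr -addr_eq0 addrC H.
have : dlogIm f 0 = 0.
  by rewrite /dlogIm f1E; case: (f.[0]) => a b /=; simpc => /=; ring.
have [/(dlogIm_lt0 fr)|sf _] := ltnP 1 (size f); first by move=> + e0; rewrite e0 ltxx.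
have [a fE] : exists a, f = a%:P by exists f`_0; exact: size1_polyC.
move/eqP: f1E; rewrite {1}fE derivC horner0 eq_sym mulf_eq0 (negbTE fn0) orbF.
by rewrite oppr_eq0 => /eqP [] d0'; move: d0; rewrite d0' ltxx.
Qed.

(** Limit of [stable_add_psum] as [d] tends to 0: a zero in the upper half-plane would propagate to
    a positive real point, where the nonzero coefficient makes the value positive. *)
Lemma stable_psum T c S0 : nonneg c -> stable c -> psum T c S0 != 0 ->
  stable (psum T c).
Proof.
move=> nc sc p0 z z0; apply/eqP => cz0.
have [||y [K [y0 K0 h]]] := @stable_growth z.
- by move=> j; apply/ltW.
- by move=> j e; have := z0 j; rewrite e ltxx.
have E (d : R) (x : 'I_m -> C) : cmev (fun S => d * c S + psum T c S) x =
    d%:C%C * cmev c x + cmev (psum T c) x.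
  rewrite /cmev -mev_scale -mev_add; apply: eq_bigr => S _.
  by rewrite rmorphD rmorphM.
have : (cmev (psum T c) (fun j => (y j)%:C%C))%:P.[0] +
   (cmev c (fun j => (y j)%:C%C) *: 'X).[0] = 0.
  rewrite -hornerD.
  apply: (@limit_vanish _ _ (cmev c z *: 'X) K) => //; last by rewrite !hornerE.
  move=> d; rewrite ltcE; case: d => d d' /= /andP [/eqP -> d0] _.
  have := h _ 0 (stable_add_psum T sc d0) _ (lexx 0).
  have e0 (x : 'I_m -> C) c' : cmev c' (fun j => x j + 0 * 'i%C) = cmev c' x.
    by apply: eq_mev => j; rewrite mul0r addr0.
  rewrite (e0 z) (e0 (fun j => (y j)%:C%C)) !E cz0 addr0 !hornerE.
  rewrite addrC [_ * d%:C%C]mulrC [cmev c z * _]mulrC; apply => j.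
  by rewrite addr0.
rewrite !hornerE cmev_real => -[] my.
by have := mev_gt0 (@nonneg_psum T _ nc) p0 y0; rewrite my ltxx.
Qed.

Lemma stable_block_rooted c T y : nonneg c -> stable c -> (forall j, 0 < y j) ->
  exists a (r : seq R), [/\ 0 < a, all (>= 0) r &
    pmev c (fun j => if j \in T then 'X else (y j)%:P) =
    a *: \prod_(x <- r) ('X + x%:P)].
Proof.
move=> nc sc y0; set g := pmev _ _.
have gE : g = pmev c (fun j => (if j \in T then 0 else y j)%:P +
    (if j \in T then 1 else 0) *: 'X).
  apply: eq_bigr => S _; congr (_ *: _); apply: eq_bigr => j _.
  by case: (j \in T); rewrite ?scale1r ?add0r // scale0r addr0.
have gpos t : 0 < t -> 0 < g.[t].
  move=> t0; rewrite horner_pmev; apply: stable_gt0 => // j.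
  by case: (j \in T); rewrite ?hornerX ?hornerC.
have [|r r0 gr] := @real_rooted _ g gpos.
  move=> w w0; rewrite gE horner_toC_pmev; apply: stable_closed => // j.
    by case: (j \in T); case: (w) w0 => w1 w2 /=; simpc => //; exact: ltW.
  case: (j \in T); case: (w) w0 => w1 w2 /=; simpc => // w0 e.
  by rewrite e ltxx in w0.
exists (lead_coef g), r; split=> //.
have := gpos 1 ltr01; rewrite gr hornerZ pmulr_lgt0 -?gr //.
rewrite horner_prod; elim: r r0 {gr} => [_|x r IH /= /andP [x0 r0]].
  by rewrite big_nil.
rewrite big_cons mulr_gt0 ?IH //.
by rewrite hornerD hornerX hornerC ltr_pwDl.
Qed.

End Stable.

(** * Monotonicity of tilted marginals *)

Section Monotone.
Variable R : realType.
Implicit Types (A B : {poly R}).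

Lemma ratio_le A B (u v : R) : u <= v ->
  (forall t, u <= t <= v -> 0 < A.[t]) ->
  (forall t, 0 <= A.[t] * B^`().[t] - A^`().[t] * B.[t]) ->
  B.[u] / A.[u] <= B.[v] / A.[v].
Proof.
move=> uv Apos W; pose f (t : R) := B.[t] * (A.[t])^-1.
pose df (t : R) := (A.[t] * B^`().[t] - A^`().[t] * B.[t]) / A.[t] ^+ 2.
have fd t : u <= t <= v -> is_derive t 1 f (df t).
  move=> /Apos At; have An0 : A.[t] != 0 by rewrite gt_eqF.
  have dV := @is_deriveV R (horner A) t A^`().[t] 1 An0 (is_derive_poly A t).
  apply: is_derive_eq; rewrite /GRing.scale /= /df; field.
  done.
have [||c _ E] := @MVT_segment R f df u v uv.
- by move=> x; rewrite in_itv /= => /andP [/ltW ux /ltW xv]; apply: fd; rewrite ux.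
- apply: derivable_within_continuous => x; rewrite in_itv /= => /fd h.
  exact: ex_derive.
rewrite -subr_ge0 -/(f u) -/(f v) E mulr_ge0 ?subr_ge0 //.
by rewrite /df divr_ge0 // sqr_ge0.
Qed.

Variable m : nat.
Implicit Types (c : {set 'I_m} -> R) (y b e : 'I_m -> R).
Local Notation Re := (@complex.Re R).
Local Notation Im := (@complex.Im R).

Lemma horner_affine c b e t : (pmev c (fun j => (b j)%:P + e j *: 'X)).[t] =
  mev c (fun j => b j + e j * t).
Proof. by rewrite horner_pmev; apply: eq_mev => j; rewrite !hornerE. Qed.

(** On the segment from [y] to [y'] the coordinate [s] is constant. Adding ['i] to it produces
    [A + 'i B] with [A] the polynomial and [B] its [s]-derivative, still free of zeros, so [B / A]
    decreases. *)
Lemma marginal_decr c s y y' : nonneg c -> stable c ->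
  (forall j, 0 < y j) -> (forall j, y j <= y' j) -> y s = y' s ->
  mev (pdel s c) y' / mev c y' <= mev (pdel s c) y / mev c y.
Proof.
move=> nc sc y0 yy' ys; pose e j := y' j - y j.
have e0 j : 0 <= e j by rewrite subr_ge0.
pose L d := pmev d (fun j => (y j)%:P + e j *: 'X).
have L0 d : (L d).[0] = mev d y.
  by rewrite horner_affine; apply: eq_mev => j; rewrite mulr0 addr0.
have L1 d : (L d).[1] = mev d y'.
  by rewrite horner_affine; apply: eq_mev => j; rewrite mulr1 addrC subrK.
rewrite -!L0 -!L1 -lerN2 -!mulNr -!hornerN; apply: ratio_le => // t.
  case/andP=> t0 _; rewrite horner_affine; apply: stable_gt0 => // j.
  by rewrite ltr_wpDr // mulr_ge0.
rewrite derivN !hornerN !mulrN -opprB oppr_ge0 opprK addrC.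
apply: hermite_biehler => w w0; rewrite !horner_toC_pmev.
pose z j := (y j)%:C%C + (e j)%:C%C * w.
pose z' j := if j == s then z s + 'i%C else z j.
have -> : cmev c z + 'i%C * cmev (pdel s c) z = cmev c z'.
  rewrite cmev_pdel [RHS](@mev_upd _ _ s _ z).
    by rewrite /z' eqxx [z s + _]addrC addrK.
  by move=> i /negbTE; rewrite /z' => ->.
have E j : Im (z' j) = if j == s then 1 else e j * Im w.
  rewrite /z' /z; case: eqP => _; last first.
    by case: (w) => w1 w2 /=; simpc => /=; ring.
  by rewrite /e ys subrr; case: (w) => w1 w2 /=; simpc => /=; ring.
apply: stable_closed => // j; rewrite E.
  by case: eqP => // _; rewrite mulr_ge0 // ltW.
case: eqP => [_ /eqP|/eqP js /eqP]; first by rewrite oner_eq0.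
rewrite mulf_eq0 (gt_eqF w0) orbF => /eqP ej.
by rewrite /z' (negbTE js) /z ej mul0r addr0 /=; exact: y0.
Qed.

(** Arguments add up, so slopes at most [d] give a product of slope about [size r * d]; the factor 2
    absorbs the second-order terms while [d * (2 * k.+1) <= 1]. *)
Lemma cone_prod (r : seq R[i]) (d : R) (k : nat) : (size r <= k)%N ->
  0 <= d -> d * (2 * k.+1%:R) <= 1 ->
  (forall x, x \in r -> 0 < Re x /\ `|Im x| <= d * Re x) ->
  0 < Re (\prod_(x <- r) x) /\
  `|Im (\prod_(x <- r) x)| <= (2 * (size r)%:R * d) * Re (\prod_(x <- r) x).
Proof.
elim: r => [_ _ _ _|a r IH /= szr d0 dk hr].
  by rewrite big_nil /= normr0 mulr0 !mul0r; split.
have [||||p0 pI] := IH => //; first exact: ltnW.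
  by move=> x xr; apply: hr; rewrite inE xr orbT.
have [a0 aI] : 0 < Re a /\ `|Im a| <= d * Re a by apply: hr; rewrite inE eqxx.
rewrite big_cons; move: p0 pI; set p := \prod_(x <- r) x.
move: a0 aI; case: a {hr} => a b /=; case: p => u v /= a0 aI u0 vI; simpc => /=.
set N : R := (size r)%:R; have N0 : 0 <= N by rewrite ler0n.
have NK : N + 1 <= k%:R by rewrite /N natr1 ler_nat.
have dN : d * (2 * (N + 1)) <= 1.
  apply: le_trans dk; apply: ler_wpM2l => //; apply: ler_wpM2l => //.
  by rewrite (le_trans NK) // ler_nat.
have bv : `|b * v| <= (2 * N * d ^+ 2) * (a * u).
  rewrite normrM.
  have -> : 2 * N * d ^+ 2 * (a * u) = (d * a) * (2 * N * d * u) by ring.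
  exact: ler_pM.
have cross : `|a * v + b * u| <= (2 * N * d + d) * (a * u).
  rewrite (le_trans (ler_normD _ _)) // !normrM !(gtr0_norm a0) !(gtr0_norm u0).
  have -> : (2 * N * d + d) * (a * u) = a * (2 * N * d * u) + d * a * u by ring.
  by rewrite lerD // ?ler_wpM2l ?ler_wpM2r // ltW.
have au : 0 < a * u by rewrite mulr_gt0.
have lower : (1 - 2 * N * d ^+ 2) * (a * u) <= a * u - b * v.
  rewrite mulrBl mul1r lerB // (le_trans _ bv) // ler_norm.
  done.
have dd : (2 * (N + 1) * d) ^+ 2 <= 1.
  rewrite mulrC in dN; rewrite expr_le1 // !mulr_ge0 // addr_ge0 //.
have q0 : 0 < 1 - 2 * N * d ^+ 2 by nra.
split; first by apply: lt_le_trans lower; rewrite mulr_gt0.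
apply: (le_trans cross); rewrite -[(size r).+1%:R]natr1 -/N.
have K0 : 0 <= 2 * (N + 1) * d by rewrite !mulr_ge0 // addr_ge0.
apply: le_trans (ler_wpM2l K0 lower); rewrite [leRHS]mulrA ler_pM2r //.
nra.
Qed.

(* Replacing the coordinate [z_s = t] by [(1 - i d) t] leaves a polynomial in [t]
   without zeros in the upper half-plane:
   if [(1 - i d) w] stays there, use stability; otherwise [w], and with it every
   coordinate, is so close to the positive axis that all monomials have positive
   real part. *)
Lemma marginal_incr c s b e (t1 t2 : R) : nonneg c -> stable c ->
  (forall j, 0 <= b j) -> (forall j, 0 <= e j) -> (forall j, 0 < b j + e j) ->
  b s = 0 -> e s = 1 -> 0 < t1 -> t1 <= t2 ->
  t1 * mev (pdel s c) (fun j => b j + e j * t1) / mev c (fun j => b j + e j * t1)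
  <= t2 * mev (pdel s c) (fun j => b j + e j * t2) /
     mev c (fun j => b j + e j * t2).
Proof.
move=> nc sc b0 e0 be bs es t10 t12.
pose L c' := pmev c' (fun j => (b j)%:P + e j *: 'X).
have BE t : ('X * L (pdel s c)).[t] = t * mev (pdel s c) (fun j => b j + e j * t).
  by rewrite hornerM hornerX horner_affine.
rewrite -!BE -!horner_affine; apply: ratio_le => // t.
  case/andP=> tt _; rewrite horner_affine; apply: stable_gt0 => // j.
  have t0 : 0 < t by exact: lt_le_trans tt.
  have := e0 j; rewrite le_eqVlt => /predU1P [ej|ej].
    by have := be j; rewrite -ej addr0 mul0r addr0.
  by rewrite ltr_wpDl // mulr_gt0.
(* The widest cone that [cone_prod] allows for monomials of degree at most [m]. *)
pose d : R := (2 * m.+1%:R)^-1.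
have d0 : 0 < d by rewrite invr_gt0 mulr_gt0.
have d1 : d * (2 * m.+1%:R) = 1 by rewrite mulVf // mulf_neq0 // pnatr_eq0.
have dle1 : d <= 1.
  by rewrite -d1 ler_peMr ?(ltW d0) // -natrM ler1n mulnS.
(* Replacing [t] by [(1 - 'i d) t] in coordinate [s] adds ['i] times [- d * t] times the
   [s]-derivative; the factor [- d] turns the Hermite-Biehler decrease into an increase. *)
suff : (L c).[t] * ((- d) *: ('X * L (pdel s c)))^`().[t] -
    (L c)^`().[t] * ((- d) *: ('X * L (pdel s c))).[t] <= 0.
  rewrite derivZ !hornerZ => h; rewrite -(ler_pM2l d0) mulr0 -oppr_le0.
  by apply: le_trans h; rewrite le_eqVlt; apply/orP; left; apply/eqP; ring.
apply: hermite_biehler => w w0.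
pose z j := (b j)%:C%C + (e j)%:C%C * w.
pose z' j := if j == s then z s - 'i%C * d%:C%C * w else z j.
have -> : (toC (L c)).[w] + 'i%C * (toC (- d *: ('X * L (pdel s c)))).[w] =
    cmev c z'.
  rewrite [RHS](@mev_upd _ _ s _ z); last first.
    by move=> i /negbTE; rewrite /z' => ->.
  rewrite /toC map_polyZ rmorphM /= map_polyX hornerZ hornerM hornerX.
  rewrite -!/(toC _) !horner_toC_pmev -cmev_pdel /z' eqxx [z s - _]addrC addrK.
  by rewrite rmorphN /= -/z -/(cmev c z); ring.
have z's : z' s = w - 'i%C * d%:C%C * w.
  by rewrite /z' eqxx /z bs es add0r mul1r.
have z'j j : j != s -> z' j = z j by rewrite /z' => /negbTE ->.
have zE j : Re (z j) = b j + e j * Re w /\ Im (z j) = e j * Im w.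
  by rewrite /z; case: (w) => w1 w2 /=; simpc => /=; split; ring.
have [z's_Re z's_Im] : Re (z' s) = Re w + d * Im w /\ Im (z' s) = Im w - d * Re w.
  by rewrite z's; case: (w) => w1 w2 /=; simpc => /=; split; ring.
have [wd|wd] := ltP (d * Re w) (Im w).
  apply: stable_closed => // j; have [->|js] := eqVneq j s.
  - by rewrite z's_Im subr_ge0 ltW.
  - by rewrite z'j //; case: (zE j) => _ ->; rewrite mulr_ge0 // ltW.
  - by rewrite z's_Im => /eqP; rewrite subr_eq0 (gt_eqF wd).
  rewrite z'j //; case: (zE j) => -> -> /eqP; rewrite mulf_eq0 (gt_eqF w0) orbF.
  by move=> /eqP ej; have := be j; rewrite ej mul0r addr0.
have Rw : 0 < Re w by rewrite -(pmulr_rgt0 _ d0); exact: lt_le_trans wd.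
have cone j : 0 < Re (z' j) /\ `|Im (z' j)| <= d * Re (z' j).
  have [->|js] := eqVneq j s.
    rewrite z's_Re z's_Im; split; first by rewrite addr_gt0 // mulr_gt0.
    rewrite ler0_norm ?subr_le0 // opprB mulrDr.
    by apply: ler_wpDr; [rewrite !mulr_ge0 // ltW | rewrite gerBl ltW].
  rewrite z'j //; case: (zE j) => -> ->; split.
    have := e0 j; rewrite le_eqVlt => /predU1P [ej|ej].
      by have := be j; rewrite -ej addr0 mul0r addr0.
    by rewrite ltr_wpDl // mulr_gt0.
  rewrite ger0_norm ?mulr_ge0 //; last exact: ltW.
  rewrite mulrDr; apply: ler_wpDl; first by rewrite mulr_ge0 // ltW.
  by rewrite mulrCA ler_wpM2l.
have [S0 cS0] := stable_neq0 sc.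
suff : 0 < Re (cmev c z') by apply: contraTneq => ->; rewrite ltxx.
have ReE : Re (cmev c z') = \sum_S c S * Re (\prod_(i in S) z' i).
  rewrite /cmev /mev raddf_sum; apply: eq_bigr => S _.
  by case: (\prod_(i in S) z' i) => p q /=; simpc.
have prodpos S : 0 < Re (\prod_(i in S) z' i).
  rewrite -big_enum -(big_map z' predT id) /=.
  have [||||//] := @cone_prod [seq z' i | i in S] d m.
  - by rewrite size_map -cardE -[X in (_ <= X)%N](card_ord m) max_card.
  - exact: ltW.
  - by rewrite d1.
  - by move=> x /mapP [j _ ->].
rewrite ReE (bigD1 S0) //= ltr_pwDl //.
  by apply: mulr_gt0 => //; rewrite lt_neqAle eq_sym cS0 nc.
by rewrite sumr_ge0 // => S _; rewrite mulr_ge0 // ltW.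
Qed.

End Monotone.

(** * Extremal products of Bernoulli generating functions *)

Section Bernoulli.
Variable R : realFieldType.
Implicit Types (q : seq R) (y : R).

(* For a fixed sum of the [q]'s, the product is smallest when all of them but one
   are [0] or [1]. *)
Lemma bernoulli_prod_ge q y : -1 <= y -> all (fun x => 0 <= x <= 1) q ->
  exists k (f : R), [/\ 0 <= f <= 1, \sum_(x <- q) x = k%:R + f &
    (1 + y) ^+ k * (1 + f * y) <= \prod_(x <- q) (1 + x * y)].
Proof.
move=> y1; have y1' : 0 <= 1 + y by rewrite -lerBlDl sub0r.
elim: q => [_|a q IH /= /andP [/andP [a0 a1] /IH [k [f [/andP [f0 f1] sE pE]]]]].
  by exists 0%N, 0; rewrite !big_nil lexx ler01 addr0 mul0r addr0 mulr1.
have ay : 0 <= 1 + a * y by nra.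
(* The pair [a], [f] becomes [0], [a + f] or [1], [a + f - 1]. The sum is kept and the product drops
   by [a * f * y ^+ 2], respectively [(1 - a) * (1 - f) * y ^+ 2]. *)
have [h|h] := lerP (a + f) 1.
  exists k, (a + f); rewrite h addr_ge0 // !big_cons sE addrCA; split=> //.
  apply: le_trans (ler_wpM2l ay pE); rewrite mulrCA ler_wpM2l ?exprn_ge0 //.
  by have := mulr_ge0 (mulr_ge0 a0 f0) (sqr_ge0 y); nra.
exists k.+1, (a + f - 1); rewrite !big_cons sE -natr1; split.
- by apply/andP; split; lra.
- by ring.
apply: le_trans (ler_wpM2l ay pE); rewrite mulrCA exprSr -mulrA.
rewrite ler_wpM2l ?exprn_ge0 //.
have a1' : 0 <= 1 - a by lra.
have f1' : 0 <= 1 - f by lra.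
by have := mulr_ge0 (mulr_ge0 a1' f1') (sqr_ge0 y); nra.
Qed.

(** In the extremal case with sum [k + f], either [k >= K], or [k = K - 1] and [f >= eps], whence
    [1 + f * y >= eps * (1 + y)]. *)
Lemma bernoulli_prod_up q y (eps : R) K : 0 <= y -> 0 < eps -> eps <= 1 ->
  all (fun x => 0 <= x <= 1) q -> K%:R - 1 + eps <= \sum_(x <- q) x ->
  eps * (1 + y) ^+ K <= \prod_(x <- q) (1 + x * y).
Proof.
move=> y0 e0 e1 q01; have yN1 : -1 <= y by lra.
have [k [f [/andP [f0 f1] -> pE]]] := bernoulli_prod_ge yN1 q01.
move=> Kk; apply: le_trans pE.
have y1 : 1 <= 1 + y by rewrite lerDl.
have [Kk'|Kk'] := leqP K k.
  rewrite -[eps * _]mulrC; apply: ler_pM => //.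
  - by rewrite exprn_ge0 // (le_trans ler01).
  - exact: ltW.
  - by rewrite ler_weXn2l.
  by rewrite (le_trans e1) // lerDl mulr_ge0.
have KE : K = k.+1.
  apply/eqP; rewrite eqn_leq Kk' andbT leqNgt; apply/negP => kK.
  have : k.+2%:R <= K%:R :> R by rewrite ler_nat.
  by rewrite -!natr1; lra.
rewrite KE exprSr mulrCA; apply: ler_wpM2l.
  by rewrite exprn_ge0 // (le_trans ler01).
have ef : eps <= f by move: Kk; rewrite KE -natr1; lra.
by nra.
Qed.

(** Here either [k < K], or [k = K] and [f <= 1 - eps], whence [1 + f * y >= eps] because
    [y >= -1]. *)
Lemma bernoulli_prod_down q y (eps : R) K : -1 <= y -> y <= 0 -> 0 < eps ->
  eps <= 1 -> all (fun x => 0 <= x <= 1) q ->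
  \sum_(x <- q) x <= K%:R + 1 - eps ->
  eps * (1 + y) ^+ K <= \prod_(x <- q) (1 + x * y).
Proof.
move=> y0 y1 e0 e1 q01.
have [k [f [/andP [f0 f1] -> pE]]] := bernoulli_prod_ge y0 q01.
move=> Kk; apply: le_trans pE.
have y1' : 0 <= 1 + y by rewrite -lerBlDl sub0r.
have fy : 1 + y <= 1 + f * y by nra.
have [kK|kK] := ltnP k K.
  apply: (@le_trans _ _ ((1 + y) ^+ k.+1)); last first.
    by rewrite exprSr ler_wpM2l ?exprn_ge0.
  apply: (@le_trans _ _ ((1 + y) ^+ K)); first by rewrite ler_piMl ?exprn_ge0.
  by apply: ler_wiXn2l => //; rewrite gerDl.
have KE : k = K.
  apply/eqP; rewrite eqn_leq kK andbT leqNgt; apply/negP => kK'.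
  have : K.+1%:R <= k%:R :> R by rewrite ler_nat.
  by rewrite -!natr1; lra.
rewrite KE mulrC; apply: ler_wpM2l; first by rewrite exprn_ge0.
have ef : f <= 1 - eps by move: Kk; rewrite KE; lra.
by nra.
Qed.

Lemma deriv_prod_XaddC (r : seq R) (t : R) : 0 < t -> all (>= 0) r ->
  (\prod_(x <- r) ('X + x%:P))^`().[t] =
  (\prod_(x <- r) ('X + x%:P)).[t] * \sum_(x <- r) (t + x)^-1.
Proof.
move=> t0; elim: r => [_|x r IH /= /andP [x0 r0]].
  by rewrite !big_nil derivC horner0 mulr0.
have tx : t + x != 0 by rewrite gt_eqF // ltr_pwDl.
rewrite !big_cons derivM derivD derivX derivC addr0 mul1r hornerD !hornerM IH //.
by rewrite hornerD hornerX hornerC; field.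
Qed.

End Bernoulli.

(** * The capacity lower bound *)

Section Capacity.
Variables (R : realType) (m : nat) (c : {set 'I_m} -> R).
Hypotheses (nc : nonneg c) (sc : stable c) (c1 : mev c (fun=> 1) = 1).
Implicit Types (y : 'I_m -> R) (T : {set 'I_m}).

(** A root [- x] of the block polynomial yields a Bernoulli parameter [u / (u + x)]: one has [v + x
    = (u + x) * (1 + u / (u + x) * (v / u - 1))], and the parameters sum to [u] times the
    logarithmic derivative. *)
Lemma scale_block y y' T (u v : R) : 0 < u -> 0 < v -> (forall j, 0 < y j) ->
  (forall j, j \in T -> y j = u) -> (forall j, j \in T -> y' j = v) ->
  (forall j, j \notin T -> y' j = y j) ->
  exists q : seq R, [/\ all (fun x => 0 <= x <= 1) q,
    \sum_(x <- q) x = \sum_(s in T) u * mev (pdel s c) y / mev c y &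
    mev c y' = mev c y * \prod_(x <- q) (1 + x * (v / u - 1))].
Proof.
move=> u0 v0 y0 yT y'T y'N.
have [a [r [a0 r0 gE]]] := stable_block_rooted T nc sc y0.
set g := pmev _ _ in gE.
have gu d : (pmev d (fun j => if j \in T then 'X else (y j)%:P)).[u] = mev d y.
  rewrite horner_pmev; apply: eq_mev => j; case: ifP => [/yT ->|_].
    by rewrite hornerX.
  by rewrite hornerC.
have gv : g.[v] = mev c y'.
  rewrite horner_pmev; apply: eq_mev => j; case: ifP => [/y'T ->|/negbT /y'N ->].
    by rewrite hornerX.
  by rewrite hornerC.
have g'u : g^`().[u] = \sum_(s in T) mev (pdel s c) y.
  rewrite deriv_pmev horner_sum [RHS]big_mkcond /=; apply: eq_bigr => s _.
  rewrite hornerM gu; case: (s \in T); first by rewrite derivX hornerC mul1r.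
  by rewrite derivC hornerC mul0r.
have cy : 0 < mev c y by exact: stable_gt0.
have ux x : x \in r -> 0 < u + x by move=> /(allP r0) /= x0; rewrite ltr_pwDl.
exists [seq u / (u + x) | x <- r]; split.
- apply/allP => _ /mapP [x xr ->]; have x0 := allP r0 _ xr.
  by rewrite divr_ge0 ?(ltW u0) ?(ltW (ux _ xr)) //= ler_pdivrMr ?ux // mul1r lerDl.
- rewrite -mulr_suml -mulr_sumr -g'u -(gu c) -/g gE derivZ !hornerZ.
  rewrite deriv_prod_XaddC // big_map -mulr_sumr.
  have gn : g.[u] != 0 by rewrite gu gt_eqF.
  move: gn; rewrite gE hornerZ mulf_eq0 negb_or => /andP [an pn].
  by field; rewrite an pn.
rewrite -gv -(gu c) -/g gE !hornerZ -mulrA; congr (_ * _).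
rewrite big_map !horner_prod -big_split /=; rewrite !big_seq; apply: eq_bigr => x xr.
have := ux x xr; rewrite !hornerD !hornerX !hornerC => h.
by field; rewrite !gt_eqF.
Qed.

(** Two moves: raising the coordinates below 1 to 1 can only lower the marginal, by [marginal_decr];
    the resulting point is reached from the all-ones point by an affine move to which
    [marginal_incr] applies. *)
Lemma marginal_up s y (u : R) : 1 <= u -> (forall j, 0 < y j) ->
  (forall j, y j <= u) -> y s = u ->
  mev (pdel s c) (fun=> 1) <= u * mev (pdel s c) y / mev c y.
Proof.
move=> u1 y0 yu ys; pose y1 j := Num.max 1 (y j).
have u0 : 0 < u by exact: lt_le_trans u1.
have y1s : y1 s = u by rewrite /y1 ys; apply/max_idPr.
have y1u j : 1 <= y1 j <= u by rewrite le_max lexx ge_max u1 yu.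
have yy1 j : y j <= y1 j by rewrite le_max lexx orbT.
have : mev (pdel s c) y1 / mev c y1 <= mev (pdel s c) y / mev c y.
  by apply: marginal_decr => //; rewrite y1s.
rewrite -(ler_pM2l u0) !mulrA; apply: le_trans.
have [ue|un] := eqVneq u 1.
  have y1E : y1 =1 (fun=> 1).
    by move=> j; apply/eqP; rewrite eq_le andbC; have := y1u j; rewrite ue.
  by rewrite !(eq_mev _ y1E) c1 divr1 ue mul1r.
have up : 0 < u - 1 by rewrite subr_gt0 lt_neqAle eq_sym un.
(* Chosen so that [1 - e j + e j * t] is 1 at [t = 1] and [y1 j] at [t = u]. *)
pose e j := (y1 j - 1) / (u - 1).
have e0 j : 0 <= e j.
  by rewrite divr_ge0 // ?(ltW up) // subr_ge0; case/andP: (y1u j).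
have e1 j : e j <= 1.
  by rewrite ler_pdivrMr // mul1r lerB //; case/andP: (y1u j).
have es : e s = 1 by rewrite /e y1s divff // gt_eqF.
have := @marginal_incr _ _ c s (fun j => 1 - e j) e 1 u nc sc _ e0 _ _ es ltr01 u1.
have E1 d : mev d (fun j => 1 - e j + e j * 1) = mev d (fun=> 1).
  by apply: eq_mev => j; rewrite mulr1 subrK.
have Eu d : mev d (fun j => 1 - e j + e j * u) = mev d y1.
  by apply: eq_mev => j; rewrite /e; field; rewrite gt_eqF.
rewrite !E1 !Eu c1 divr1 mul1r; apply.
- by move=> j; rewrite subr_ge0.
- by move=> j; rewrite subrK.
- by rewrite es subrr.
Qed.

(** The same affine move, now traversed from [y] at [t = u] up to the all-ones point at [t = 1]. *)
Lemma marginal_down s y (u : R) : 0 < u -> u <= 1 ->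
  (forall j, u <= y j <= 1) -> y s = u ->
  u * mev (pdel s c) y / mev c y <= mev (pdel s c) (fun=> 1).
Proof.
move=> u0 u1 yu ys.
have [ue|un] := eqVneq u 1.
  have yE : y =1 (fun=> 1).
    by move=> j; apply/eqP; rewrite eq_le andbC; have := yu j; rewrite ue.
  by rewrite !(eq_mev _ yE) c1 divr1 ue mul1r.
have up : 0 < 1 - u by rewrite subr_gt0 lt_neqAle un.
pose e j := (1 - y j) / (1 - u).
have e0 j : 0 <= e j.
  by rewrite divr_ge0 // ?(ltW up) // subr_ge0; case/andP: (yu j).
have e1 j : e j <= 1.
  by rewrite ler_pdivrMr // mul1r lerB //; case/andP: (yu j).
have es : e s = 1 by rewrite /e ys divff // gt_eqF.
have := @marginal_incr _ _ c s (fun j => 1 - e j) e u 1 nc sc _ e0 _ _ es u0 u1.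
have E1 d : mev d (fun j => 1 - e j + e j * 1) = mev d (fun=> 1).
  by apply: eq_mev => j; rewrite mulr1 subrK.
have Eu d : mev d (fun j => 1 - e j + e j * u) = mev d y.
  by apply: eq_mev => j; rewrite /e; field; rewrite gt_eqF.
rewrite !E1 !Eu c1 divr1 mul1r; apply.
- by move=> j; rewrite subr_ge0.
- by move=> j; rewrite subrK.
- by rewrite es subrr.
Qed.

Lemma raise_block y y' T (u v eps : R) K :
  1 <= u -> u <= v -> (forall j, 0 < y j) -> (forall j, y j <= u) ->
  (forall j, j \in T -> y j = u) -> (forall j, j \in T -> y' j = v) ->
  (forall j, j \notin T -> y' j = y j) -> 0 < eps -> eps <= 1 ->
  K%:R - 1 + eps <= \sum_(s in T) mev (pdel s c) (fun=> 1) ->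
  eps * (v / u) ^+ K * mev c y <= mev c y'.
Proof.
move=> u1 uv y0 yu yT y'T y'N e0 e1 hK.
have u0 : 0 < u by exact: lt_le_trans u1.
have v0 : 0 < v by exact: lt_le_trans uv.
have [q [q01 sE ->]] := scale_block u0 v0 y0 yT y'T y'N.
rewrite mulrC ler_pM2l; last exact: stable_gt0.
have -> : v / u = 1 + (v / u - 1) by rewrite addrC subrK.
rewrite {2}[1 + _]addrC subrK; apply: bernoulli_prod_up => //.
  by rewrite subr_ge0 ler_pdivlMr // mul1r.
rewrite sE (le_trans hK) //; apply: ler_sum => s sT; apply: marginal_up => //.
exact: yT.
Qed.

Lemma lower_block y y' T (u v eps : R) K :
  u <= 1 -> v <= u -> 0 < v -> (forall j, u <= y j <= 1) ->
  (forall j, j \in T -> y j = u) -> (forall j, j \in T -> y' j = v) ->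
  (forall j, j \notin T -> y' j = y j) -> 0 < eps -> eps <= 1 ->
  \sum_(s in T) mev (pdel s c) (fun=> 1) <= K%:R + 1 - eps ->
  eps * (v / u) ^+ K * mev c y <= mev c y'.
Proof.
move=> u1 vu v0 yu yT y'T y'N e0 e1 hK.
have u0 : 0 < u by exact: lt_le_trans vu.
have y0 j : 0 < y j by case/andP: (yu j) => h _; exact: lt_le_trans h.
have [q [q01 sE ->]] := scale_block u0 v0 y0 yT y'T y'N.
rewrite mulrC ler_pM2l; last exact: stable_gt0.
have -> : v / u = 1 + (v / u - 1) by rewrite addrC subrK.
rewrite {2}[1 + _]addrC subrK; apply: bernoulli_prod_down => //.
- by rewrite lerBrDr addNr divr_ge0 // ltW.
- by rewrite subr_le0 ler_pdivrMr // mul1r.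
rewrite sE (le_trans _ hK) //; apply: ler_sum => s sT; apply: marginal_down => //.
exact: yT.
Qed.

Variables (n : nat) (blk : 'I_m -> 'I_n) (kappa : 'I_n -> nat) (eps : R).
Implicit Types (a x : 'I_n -> R) (U : {set 'I_n}).

(** [pol] is the generating polynomial of the block sums and [alpha] gives their means, as [mev c]
    is 1 at the all-ones point. *)
Let pol x := mev c (fun j => x (blk j)).
Let mono x := \prod_i x i ^+ kappa i.
Let alpha i := \sum_(s | blk s == i) mev (pdel s c) (fun=> 1).

Hypotheses (eps0 : 0 < eps) (close : \sum_i `|alpha i - (kappa i)%:R| <= 1 - eps).

Let eps1 : eps <= 1.
Proof. by rewrite -subr_ge0; apply: le_trans close; exact: sumr_ge0. Qed.

Let alpha_set U :
  \sum_(s in [set s | blk s \in U]) mev (pdel s c) (fun=> 1) = \sum_(i in U) alpha i.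
Proof.
rewrite (partition_big blk (mem U)) /=; last by move=> s; rewrite inE.
apply: eq_bigr => i iU; apply: eq_bigl => s; rewrite inE.
by case: eqP => [->|]; rewrite ?iU ?andbF.
Qed.

(** The 1-norm hypothesis controls every union of blocks at once, which lets a whole level set move
    as one block. *)
Let alpha_close U :
  `|\sum_(i in U) alpha i - (\sum_(i in U) kappa i)%:R| <= 1 - eps.
Proof.
rewrite natr_sum -sumrB; apply: le_trans close.
rewrite (le_trans (ler_norm_sum _ _ _)) // [leRHS](bigID (mem U)) /=.
by rewrite lerDl sumr_ge0.
Qed.

Let mono_set a a' U (u v : R) : u != 0 ->
  (forall i, i \in U -> a i = u) -> (forall i, i \in U -> a' i = v) ->
  (forall i, i \notin U -> a' i = a i) ->
  mono a' = (v / u) ^+ (\sum_(i in U) kappa i) * mono a.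
Proof.
move=> u0 aU a'U a'N.
have -> : (v / u) ^+ (\sum_(i in U) kappa i) =
    \prod_i (if i \in U then (v / u) ^+ kappa i else 1).
  rewrite -big_mkcond /=.
  by elim/big_rec2: _ => [|i p k _ <-]; rewrite ?expr0 // exprD.
rewrite /mono -big_split /=; apply: eq_bigr => i _; case: ifP => iU.
  by rewrite a'U // aU // -exprMn divfK.
by rewrite mul1r a'N ?iU.
Qed.

Let mono_gt0 x : (forall i, 0 < x i) -> 0 < mono x.
Proof. by move=> x0; apply: prodr_gt0 => i _; rewrite exprn_gt0. Qed.

(** Cross-multiplied form of [pol a' / mono a' >= eps * (pol a / mono a)]. The blocks in [U] move
    together, so only one factor [eps] is lost whatever the size of [U]. *)
Let step_up a a' U (u v : R) : 1 <= u -> u <= v -> (forall i, 0 < a i <= u) ->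
  (forall i, i \in U -> a i = u) -> (forall i, i \in U -> a' i = v) ->
  (forall i, i \notin U -> a' i = a i) ->
  eps * mono a' * pol a <= mono a * pol a'.
Proof.
move=> u1 uv a0 aU a'U a'N.
have u0 : 0 < u by exact: lt_le_trans u1.
have := @raise_block (fun j => a (blk j)) (fun j => a' (blk j))
  [set s | blk s \in U] u v eps (\sum_(i in U) kappa i)%N u1 uv.
move=> h; rewrite (mono_set _ aU a'U a'N) ?gt_eqF //.
have m0 : 0 <= mono a by apply/ltW/mono_gt0 => i; case/andP: (a0 i).
set X := (v / u) ^+ _ in h *.
have -> : eps * (X * mono a) * pol a = mono a * (eps * X * pol a) by ring.
rewrite ler_wpM2l //.
apply: h => //.
- by move=> j; case/andP: (a0 (blk j)).
- by move=> j; case/andP: (a0 (blk j)).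
- by move=> j; rewrite inE => /aU.
- by move=> j; rewrite inE => /a'U.
- by move=> j; rewrite inE => /a'N.
rewrite alpha_set; have := alpha_close U; rewrite ler_norml => /andP [h' _]; lra.
Qed.

Let step_down a a' U (u v : R) : u <= 1 -> v <= u -> 0 < v ->
  (forall i, u <= a i <= 1) ->
  (forall i, i \in U -> a i = u) -> (forall i, i \in U -> a' i = v) ->
  (forall i, i \notin U -> a' i = a i) ->
  eps * mono a' * pol a <= mono a * pol a'.
Proof.
move=> u1 vu v0 a0 aU a'U a'N.
have u0 : 0 < u by exact: lt_le_trans vu.
have := @lower_block (fun j => a (blk j)) (fun j => a' (blk j))
  [set s | blk s \in U] u v eps (\sum_(i in U) kappa i)%N u1 vu v0.
move=> h; rewrite (mono_set _ aU a'U a'N) ?gt_eqF //.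
have m0 : 0 <= mono a.
  by apply/ltW/mono_gt0 => i; case/andP: (a0 i) => h' _; exact: lt_le_trans h'.
set X := (v / u) ^+ _ in h *.
have -> : eps * (X * mono a) * pol a = mono a * (eps * X * pol a) by ring.
rewrite ler_wpM2l //.
apply: h => //.
- by move=> j; rewrite inE => /aU.
- by move=> j; rewrite inE => /a'U.
- by move=> j; rewrite inE => /a'N.
rewrite alpha_set; have := alpha_close U; rewrite ler_norml => /andP [_ h']; lra.
Qed.

Let eq_pol x x' : x =1 x' -> pol x = pol x'.
Proof. by move=> e; apply: eq_mev => j. Qed.

Let eq_mono x x' : x =1 x' -> mono x = mono x'.
Proof. by move=> e; apply: eq_bigr => j _; rewrite e. Qed.

Let pol_gt0 x : (forall i, 0 < x i) -> 0 < pol x.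
Proof. by move=> x0; apply: stable_gt0. Qed.

Let combine (k : nat) (mx px my py mz pz : R) : 0 < my -> 0 < py ->
  0 <= mx -> 0 <= mz ->
  eps ^+ k * mx * py <= my * px -> eps * my * pz <= mz * py ->
  eps ^+ k.+1 * mx * pz <= mz * px.
Proof.
move=> my0 py0 mx0 mz0 h1 h2; rewrite -(ler_pM2r (mulr_gt0 my0 py0)).
have e0 : 0 <= eps ^+ k * mx by rewrite mulr_ge0 // exprn_ge0 // ltW.
apply: (@le_trans _ _ (eps ^+ k * mx * (mz * py) * py)).
  have := ler_wpM2l e0 h2; rewrite -(ler_pM2r py0).
  by apply: le_trans; rewrite le_eqVlt exprS; apply/orP; left; apply/eqP; ring.
have := ler_wpM2l (mulr_ge0 mz0 (ltW py0)) h1.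
have -> : mz * py * (my * px) = mz * px * (my * py) by ring.
by apply: le_trans; rewrite le_eqVlt; apply/orP; left; apply/eqP; ring.
Qed.

(** Induction on the number of coordinates above [u]: the cap rises from [u] to the smallest of
    them, which then leaves the set. *)
Let climb k x (u : R) : 1 <= u -> (forall i, 0 < x i) ->
  (#|[set i | (u < x i)%R]| <= k)%N ->
  eps ^+ k * mono x * pol (fun i => Num.min (x i) u) <=
  mono (fun i => Num.min (x i) u) * pol x.
Proof.
elim: k u => [|k IH] u u1 x0.
  rewrite leqn0 cards_eq0 => /eqP U0.
  have E : (fun i => Num.min (x i) u) =1 x.
    move=> i; apply/min_idPl; rewrite leNgt; apply/negP => h.
    by have := finset.in_set0 i; rewrite -U0 inE h.
  by rewrite expr0 mul1r (eq_pol E) (eq_mono E).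
have u0 : 0 < u by exact: lt_le_trans u1.
have min0 v : 0 < v -> forall i, 0 < Num.min (x i) v.
  by move=> v0 i; rewrite lt_min x0.
set U := [set i | (u < x i)%R] => cU.
have [U0|/finset.set0Pn [i0 i0U]] := eqVneq U finset.set0.
  have := IH u u1 x0; rewrite -/U U0 cards0 => /(_ isT).
  apply: le_trans; rewrite ler_wpM2r ?(ltW (pol_gt0 (min0 _ u0))) //.
  by rewrite ler_wpM2r ?(ltW (mono_gt0 x0)) // exprS ler_piMl ?exprn_ge0 // ltW.
case: (Order.TotalTheory.arg_minP x i0U) => j jU jmin.
have uj : u < x j by move: (jU : j \in U); rewrite /U inE.
have v1 : 1 <= x j by apply: le_trans u1 _; exact: ltW.
have {}IH := IH (x j) v1 x0 _.
apply: combine (IH _) _.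
- exact/mono_gt0/min0.
- exact/pol_gt0/min0.
- exact/ltW/mono_gt0.
- exact/ltW/mono_gt0/min0.
- rewrite -ltnS; apply: leq_trans cU; apply: proper_card; apply/properP; split.
    by apply/fintype.subsetP => i; rewrite !inE; exact: lt_trans.
  by exists j => //; rewrite inE ltxx.
apply: (@step_up _ _ U u (x j)) => //.
- exact: ltW.
- by move=> i; rewrite min0 //= ge_min lexx orbT.
- by move=> i; rewrite /U inE => h; apply/min_idPr/ltW.
- by move=> i /jmin h; apply/min_idPr.
move=> i; rewrite /U inE -leNgt => h; rewrite !min_l //.
by apply: le_trans h _; exact: ltW.
Qed.

(** Mirror image of [climb]: the floor drops from [u] to the largest coordinate below it. *)
Let descend k x (u : R) : 0 < u -> u <= 1 -> (forall i, 0 < x i <= 1) ->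
  (#|[set i | (x i < u)%R]| <= k)%N ->
  eps ^+ k * mono x * pol (fun i => Num.max (x i) u) <=
  mono (fun i => Num.max (x i) u) * pol x.
Proof.
elim: k u => [|k IH] u u0 u1 x01.
  rewrite leqn0 cards_eq0 => /eqP U0.
  have E : (fun i => Num.max (x i) u) =1 x.
    move=> i; apply/max_idPl; rewrite leNgt; apply/negP => h.
    by have := finset.in_set0 i; rewrite -U0 inE h.
  by rewrite expr0 mul1r (eq_pol E) (eq_mono E).
have x0 i : 0 < x i by case/andP: (x01 i).
have max0 v : forall i, 0 < Num.max (x i) v by move=> i; rewrite lt_max x0.
set U := [set i | (x i < u)%R] => cU.
have [U0|/finset.set0Pn [i0 i0U]] := eqVneq U finset.set0.
  have := IH u u0 u1 x01; rewrite -/U U0 cards0 => /(_ isT).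
  apply: le_trans; rewrite ler_wpM2r ?(ltW (pol_gt0 (max0 _))) //.
  by rewrite ler_wpM2r ?(ltW (mono_gt0 x0)) // exprS ler_piMl ?exprn_ge0 // ltW.
case: (Order.TotalTheory.arg_maxP x i0U) => j jU jmax.
have uj : x j < u by move: (jU : j \in U); rewrite /U inE.
have v1 : x j <= 1 by case/andP: (x01 j).
have {}IH := IH (x j) (x0 j) v1 x01 _.
apply: combine (IH _) _.
- exact/mono_gt0/max0.
- exact/pol_gt0/max0.
- exact/ltW/mono_gt0.
- exact/ltW/mono_gt0/max0.
- rewrite -ltnS; apply: leq_trans cU; apply: proper_card; apply/properP; split.
    by apply/fintype.subsetP => i; rewrite !inE => /lt_trans; apply.
  by exists j => //; rewrite inE ltxx.
apply: (@step_down _ _ U u (x j)) => //.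
- exact: ltW.
- by move=> i; rewrite le_max lexx orbT /= ge_max u1; case/andP: (x01 i) => _ ->.
- by move=> i; rewrite /U inE => h; apply/max_idPr/ltW.
- by move=> i /jmax h; apply/max_idPr.
move=> i; rewrite /U inE -leNgt => h; rewrite !max_l //.
by apply: le_trans h; exact: ltW.
Qed.

Theorem capacity_ge x : (forall i, 0 < x i) ->
  eps ^+ n * \prod_i x i ^+ kappa i <= mev c (fun j => x (blk j)).
Proof.
move=> x0; rewrite -/(mono x) -/(pol x).
(* The path goes from the all-ones point down to [y], then up from [y] to [x]. *)
pose y i := Num.min (x i) 1.
have y0 i : 0 < y i by rewrite lt_min x0 ltr01.
have y1 i : y i <= 1 by rewrite ge_min lexx orbT.
have up := climb (lexx 1) x0 (leqnn _).
have dn := @descend _ y 1 ltr01 (lexx _) _ (leqnn _).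
set k1 := #|_| in up; set k2 := #|_| in dn; rewrite -/y in up.
have M1 : (fun i => Num.max (y i) 1) =1 (fun=> 1) by move=> i; apply/max_idPr.
rewrite (eq_pol M1) (eq_mono M1) in dn.
have {}dn : eps ^+ k2 * mono y <= pol y.
  have -> : pol y = mono (fun=> 1) * pol y.
    by rewrite /mono big1 ?mul1r // => i _; rewrite expr1n.
  have -> : eps ^+ k2 * mono y = eps ^+ k2 * mono y * pol (fun=> 1).
    by rewrite /pol c1 mulr1.
  by apply: dn => i; rewrite y0 y1.
(* [k1] counts the coordinates of [x] above 1 and [k2] those below 1; no index is counted twice. *)
have kn : (k1 + k2 <= n)%N.
  rewrite /k1 /k2 -cardsUI [X in (_ + X)%N](_ : _ = 0%N) ?addn0.
    by rewrite -[X in (_ <= X)%N](card_ord n) max_card.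
  apply/eqP; rewrite cards_eq0; apply/eqP/setP => i; rewrite !inE /y.
  by apply/negP => /andP [h]; rewrite gt_min ltxx orbF => /(lt_trans h); rewrite ltxx.
have my := mono_gt0 y0.
apply: (@le_trans _ _ (eps ^+ (k1 + k2) * mono x)).
  rewrite ler_wpM2r ?(ltW (mono_gt0 x0)) //.
  by apply: ler_wiXn2l => //; exact: ltW.
rewrite -(ler_pM2l my); apply: le_trans up.
rewrite mulrCA exprD -!mulrA.
rewrite [leRHS]mulrA.
rewrite [leLHS](_ : _ = eps ^+ k1 * mono x * (eps ^+ k2 * mono y)); last by ring.
by rewrite ler_wpM2l // mulr_ge0 ?exprn_ge0 ?(ltW eps0) ?(ltW (mono_gt0 x0)).
Qed.

End Capacity.

(** * From capacity to coefficients *)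

Section Coefficient.
Variable R : realType.
Local Notation e := (expR (1 : R)).

(* [k!] times the Poisson(k) probability of [k]; equal to [1] at [k = 0]. *)
Definition poisson_peak (k : nat) : R := (k%:R / e) ^+ k.

Lemma poisson_peak_gt0 k : 0 < poisson_peak k.
Proof.
case: k => [|k]; first by rewrite /poisson_peak expr0.
by rewrite exprn_gt0 // divr_gt0 // expR_gt0.
Qed.

(** [w ^+ k * expR (- w)] peaks at [w = k]: for [k > 0] this is [1 + z <= expR z] at
    [z = w / k - 1], raised to the power [k]. *)
Lemma exprn_le_expR (w : R) k : 0 <= w -> w ^+ k <= k%:R ^+ k * expR (w - k%:R).
Proof.
case: k => [|k] w0; first by rewrite !expr0 mul1r subr0 -expR0 ler_expR.
set K : R := k.+1%:R; have K0 : 0 < K by rewrite ltr0n.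
have h : w / K <= expR (w / K - 1).
  by apply: le_trans (expR_ge1Dx _); rewrite addrC subrK.
have -> : w = K * (w / K) by rewrite mulrCA divff ?mulr1 // gt_eqF.
have -> : K * (w / K) - K = (w / K - 1) * K by ring.
rewrite exprMn ler_wpM2l ?exprn_ge0 ?(ltW K0) // expRM_natr.
by rewrite lerXn2r // nnegrE ?divr_ge0 ?expR_ge0 // ltW.
Qed.

(** [Y] and [Z] stand for the value and the derivative at [t] of a log-concave function that
    dominates [M * u ^+ k.+1]. The best [u] is inserted, and [exprn_le_expR] eliminates
    [t * Z / Y]. *)
Lemma tangent_bound (M Y Z t : R) k : 0 < M -> 0 < Y -> 0 <= Z -> 0 < t ->
  (forall u, 0 < u -> M * u ^+ k.+1 <= Y * expR ((u - t) * (Z / Y))) ->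
  M * (poisson_peak k.+1 / poisson_peak k) * t ^+ k <= Z.
Proof.
move=> M0 Y0 Z0 t0 h.
have {}Z0 : 0 < Z.
  rewrite lt_neqAle Z0 andbT; apply/negP => /eqP Z00.
  (* If [Z = 0], the upper bound is the constant [Y], which the left-hand side exceeds at
     [1 + Y / M]. *)
  have u1 : 1 <= 1 + Y / M by rewrite lerDl divr_ge0 // ltW.
  have := h (1 + Y / M) (lt_le_trans ltr01 u1).
  rewrite -Z00 mul0r mulr0 expR0 mulr1 leNgt => /negP; apply.
  apply: (@lt_le_trans _ _ (M * (1 + Y / M))).
    by rewrite mulrDr mulr1 mulrCA divff ?gt_eqF // mulr1 ltrDr.
  by rewrite ler_wpM2l ?(ltW M0) // ler_eXnr.
set K : R := k.+1%:R; have K0 : 0 < K by rewrite ltr0n.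
pose w := t * Z / Y.
have w0 : 0 <= w by rewrite divr_ge0 ?mulr_ge0 // ltW.
(* This point minimizes [expR (u * Z / Y) / u ^+ k.+1]. *)
have := h (K * Y / Z); rewrite divr_gt0 ?mulr_gt0 // => /(_ isT).
have -> : (K * Y / Z - t) * (Z / Y) = K - w.
  by rewrite /w; field; rewrite !gt_eqF.
move=> h1; have h2 := exprn_le_expR k w0.
have h3 : M * (K * Y / Z) ^+ k.+1 * w ^+ k <= Y * e ^+ k.+1 * (k%:R / e) ^+ k.
  have -> : Y * e ^+ k.+1 * (k%:R / e) ^+ k =
      Y * expR (K - w) * (k%:R ^+ k * expR (w - k%:R)).
    rewrite !expRB -/K -[K]mul1r -[k%:R in RHS]mul1r !expRM_natr exprMn mul1r.
    by rewrite exprVn; field; rewrite !gt_eqF ?exprn_gt0 ?expR_gt0.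
  apply: ler_pM => //; last by rewrite exprn_ge0.
  by rewrite mulr_ge0 ?(ltW M0) // exprn_ge0 // divr_ge0 ?mulr_ge0 // ltW.
have e0 : 0 < e by exact: expR_gt0.
have P0 := poisson_peak_gt0 k.
have Xpos : 0 < Y * (Z ^+ k)^-1 * e ^+ k.+1 / Z.
  by rewrite !mulr_gt0 ?invr_gt0 ?exprn_gt0.
rewrite mulrA mulrAC ler_pdivrMr //.
rewrite -(ler_pM2l Xpos).
have -> : Y * (Z ^+ k)^-1 * e ^+ k.+1 / Z * (Z * poisson_peak k) =
    (Y * e ^+ k.+1 * (k%:R / e) ^+ k) * (Z ^+ k)^-1.
  by rewrite /poisson_peak; field; rewrite !gt_eqF ?exprn_gt0.
have -> : Y * (Z ^+ k)^-1 * e ^+ k.+1 / Z * (M * poisson_peak k.+1 * t ^+ k) =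
    (M * (K * Y / Z) ^+ k.+1 * w ^+ k) * (Z ^+ k)^-1.
  rewrite /poisson_peak /w -/K !exprMn !exprVn !exprS.
  by field; rewrite !gt_eqF ?exprn_gt0.
by rewrite ler_wpM2r // invr_ge0 exprn_ge0 // ltW.
Qed.

Variables (m : nat).
Implicit Types (c : {set 'I_m} -> R) (y : 'I_m -> R) (S T : {set 'I_m}).

(** The block polynomial is a product of factors [u + x] with [x >= 0], each at most
    [(t + x) * expR ((u - t) / (t + x))]; their product is the tangent bound that [tangent_bound]
    requires. *)
Lemma psum_ge c T y (M : R) k : nonneg c -> stable c -> (forall j, 0 < y j) ->
  0 < M ->
  (forall t, 0 < t ->
    M * t ^+ k.+1 <= mev c (fun j => if j \in T then t else y j)) ->
  forall t, 0 < t -> M * (poisson_peak k.+1 / poisson_peak k) * t ^+ k <=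
    mev (psum T c) (fun j => if j \in T then t else y j).
Proof.
move=> nc sc y0 M0 h t t0.
have [a [r [a0 r0 gE]]] := stable_block_rooted T nc sc y0.
set g := pmev _ _ in gE.
have gu d u : (pmev d (fun j => if j \in T then 'X else (y j)%:P)).[u] =
    mev d (fun j => if j \in T then u else y j).
  rewrite horner_pmev; apply: eq_mev => j; case: ifP => _; first by rewrite hornerX.
  by rewrite hornerC.
have g't : g^`().[t] = mev (psum T c) (fun j => if j \in T then t else y j).
  rewrite deriv_pmev horner_sum mev_psum [RHS]big_mkcond /=; apply: eq_bigr => s _.
  rewrite hornerM gu; case: (s \in T); first by rewrite derivX hornerC mul1r.
  by rewrite derivC hornerC mul0r.
have pos u : 0 < u -> forall j, 0 < (if j \in T then u else y j).
  by move=> u0 j; case: ifP.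
have Y0 : 0 < g.[t] by rewrite gu; apply: stable_gt0 => //; exact: pos.
rewrite -g't; apply: (@tangent_bound _ g.[t]) => //.
  rewrite g't; apply: mev_ge0; first exact: nonneg_psum.
  by move=> j; apply/ltW/pos.
move=> u u0; apply: le_trans (h u u0) _; rewrite -gu -/g.
have tx x : x \in r -> 0 < t + x by move=> /(allP r0) /= x0; rewrite ltr_pwDl.
have gt0 : g.[t] != 0 by rewrite gt_eqF.
have -> : g^`().[t] / g.[t] = \sum_(x <- r) (t + x)^-1.
  move: gt0; rewrite gE derivZ !hornerZ mulf_eq0 negb_or => /andP [an pn].
  by rewrite deriv_prod_XaddC //; field; rewrite an pn.
rewrite gE !hornerZ -mulrA ler_pM2l // !horner_prod mulr_sumr.
elim: r r0 tx {gE} => [_ _|x r IH /= /andP [x0 r0] tx].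
  by rewrite !big_nil expR0 mulr1.
rewrite !big_cons expRD mulrACA; apply: ler_pM.
- by rewrite hornerD hornerX hornerC addr_ge0 // ltW.
- rewrite big_seq prodr_ge0 // => i ir; rewrite hornerD hornerX hornerC.
  by rewrite addr_ge0 ?(ltW u0) //; exact: (allP r0).
- have h0 : 0 < t + x by apply: tx; rewrite inE eqxx.
  rewrite !hornerD !hornerX !hornerC.
  have -> : u + x = (t + x) * (1 + (u - t) / (t + x)).
    by field; rewrite gt_eqF.
  by rewrite ler_pM2l // expR_ge1Dx.
by apply: IH => // z zr; apply: tx; rewrite inE zr orbT.
Qed.

Lemma mev_inf_le c (M : R) : nonneg c ->
  (forall t, 0 < t -> M <= mev c (fun=> t)) -> M <= c finset.set0.
Proof.
move=> nc h; pose B := \sum_S c S.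
have B0 : 0 <= B by rewrite sumr_ge0.
have key t : 0 < t -> t <= 1 -> M <= c finset.set0 + t * B.
  move=> t0 t1; apply: le_trans (h t t0) _.
  rewrite /mev /B (bigD1 finset.set0) //= big_set0 mulr1 lerD2l mulr_sumr.
  rewrite [leRHS](bigD1 finset.set0) //= ler_wpDl ?mulr_ge0 ?(ltW t0) //.
  apply: ler_sum => S /finset.set0Pn [i iS]; rewrite mulrC ler_wpM2r //.
  rewrite (bigD1 i) //= ler_piMr ?(ltW t0) //.
  by apply: prodr_ile1 => j _; rewrite (ltW t0) t1.
apply/ler_addgt0Pr => d d0; pose t := Num.min 1 (d / (1 + B)).
have B1 : 0 < 1 + B by rewrite ltr_pwDl.
have t0 : 0 < t by rewrite lt_min ltr01 divr_gt0.
apply: le_trans (key t t0 _) _; first by rewrite ge_min lexx.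
rewrite lerD2l; apply: (@le_trans _ _ (d / (1 + B) * B)).
  by rewrite ler_wpM2r // ge_min lexx orbT.
by rewrite mulrAC ler_pdivrMr // ler_wpM2l ?(ltW d0) // lerDr.
Qed.

Variables (n : nat) (blk : 'I_m -> 'I_n).
Implicit Types (k : 'I_n -> nat).

Definition block_count S (i : 'I_n) : nat := #|[set s in S | blk s == i]|.

(** Coefficient of the monomial with exponents [k] after identifying the variables of each block;
    for a law, the probability that the block sums equal [k]. *)
Definition block_coef k c : R :=
  \sum_(S | [forall i, block_count S i == k i]) c S.

Lemma block_count_setU1 S s i : s \notin S ->
  block_count (s |: S) i = ((blk s == i) + block_count S i)%N.
Proof.
move=> sS; rewrite /block_count.
case: eqP => [si|/eqP si].
  have -> : [set x in s |: S | blk x == i] = s |: [set x in S | blk x == i].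
    by apply/setP => x; rewrite !inE; have [->|] := eqVneq x s; rewrite //= si eqxx.
  by rewrite cardsU1 inE (negbTE sS).
rewrite add0n; apply: eq_card => x; rewrite !inE.
by have [->|] := eqVneq x s; rewrite //= (negbTE si) andbF.
Qed.

(** Double counting: a set with counts [k] arises once for each of its [k j] elements in block
    [j]. *)
Lemma block_coef_psum k j c : (0 < k j)%N ->
  block_coef (fun i => if i == j then (k i).-1 else k i)
    (psum [set s | blk s == j] c) = (k j)%:R * block_coef k c.
Proof.
move=> kj; rewrite /block_coef /psum exchange_big /=.
pose F S := if [forall i, block_count S i == k i] then c S else 0.
have E s : s \in [set s | blk s == j] ->
    \sum_(S | [forall i, block_count S i == if i == j then (k i).-1 else k i])
      pdel s c S = \sum_(S : {set 'I_m} | s \in S) F S.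
  rewrite inE => /eqP sj; rewrite sum_setU1 big_mkcond /= [RHS]big_mkcond /=.
  apply: eq_bigr => S _; rewrite /pdel; have [sS|sS] /= := boolP (s \in S).
    by rewrite if_same.
  rewrite /F; congr (if _ then _ else _); apply: eq_forallb => i.
  rewrite block_count_setU1 // sj [j == i]eq_sym.
  have [->|] := eqVneq i j; last by rewrite add0n.
  by rewrite add1n -(prednK kj) eqSS.
rewrite (eq_bigr _ E) (exchange_big_dep predT) //= mulr_sumr [RHS]big_mkcond /=.
apply: eq_bigr => S _; rewrite sumr_const /F.
case: forallP => [h|_]; last by rewrite mul0rn.
rewrite -(eqP (h j)) mulr_natl; congr (_ *+ _).
by apply: eq_card => s; rewrite [LHS]unfold_in /= !inE andbC.
Qed.

(** Induction on the total degree. One derivative in block [j] multiplies the capacity bound by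
    [poisson_peak (k j) / poisson_peak (k j).-1] and the coefficient by [k j]; the ratios
    telescope. *)
Theorem block_coef_ge c k (M : R) : nonneg c -> stable c -> 0 < M ->
  (forall x : 'I_n -> R, (forall i, 0 < x i) ->
    M * \prod_i x i ^+ k i <= mev c (fun j => x (blk j))) ->
  M * \prod_i (poisson_peak (k i) / (k i)`!%:R) <= block_coef k c.
Proof.
have [N] := ubnP (\sum_i k i)%N; elim: N => // N IH in c k M * => kN nc sc M0 h.
have [/forallP k0|] := boolP [forall i, k i == 0%N].
  have k0' i : k i = 0%N by exact/eqP.
  rewrite big1 => [|i _]; last by rewrite k0' /poisson_peak expr0 divr1.
  rewrite mulr1 /block_coef (bigD1 finset.set0) /=; last first.
    apply/forallP => i; rewrite k0' /block_count.
    rewrite (_ : [set s in _ | _] = finset.set0) ?cards0 //.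
    by apply/setP => s; rewrite !inE.
  rewrite ler_wpDr ?sumr_ge0 //; apply: mev_inf_le => // t t0.
  have := h (fun=> t) (fun=> t0).
  by rewrite big1 ?mulr1 // => i _; rewrite k0' expr0.
rewrite negb_forall => /existsP [j]; rewrite -lt0n => kj.
pose T := [set s | blk s == j].
pose k' i := if i == j then (k i).-1 else k i.
have k'j : k' j = (k j).-1 by rewrite /k' eqxx.
have k'N i : i != j -> k' i = k i by move=> /negbTE; rewrite /k' => ->.
pose M' := M * (poisson_peak (k j) / poisson_peak (k j).-1).
have M'0 : 0 < M' by rewrite mulr_gt0 // divr_gt0 // poisson_peak_gt0.
have h' x : (forall i, 0 < x i) ->
    M' * \prod_i x i ^+ k' i <= mev (psum T c) (fun s => x (blk s)).
  (* While only [x j] varies, the monomial [Q] of the other blocks is a constant absorbed into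
     [M]. *)
  move=> x0; pose Q := \prod_(i | i != j) x i ^+ k i.
  have Q0 : 0 < Q by apply: prodr_gt0 => i _; rewrite exprn_gt0.
  have := @psum_ge c T (fun s => x (blk s)) (M * Q) (k j).-1 nc sc _ _ _ (x j) (x0 j).
  have -> : mev (psum T c) (fun s => if s \in T then x j else x (blk s)) =
      mev (psum T c) (fun s => x (blk s)).
    by apply: eq_mev => s; rewrite inE; case: eqP => // ->.
  rewrite prednK //.
  have -> : M * Q * (poisson_peak (k j) / poisson_peak (k j).-1) * x j ^+ (k j).-1 =
      M' * \prod_i x i ^+ k' i.
    rewrite (bigD1 j) //= k'j /M' (eq_bigr (fun i => x i ^+ k i)).
      by rewrite -/Q; ring.
    by move=> i /k'N ->.
  apply=> //; first by rewrite mulr_gt0.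
  move=> t t0; pose x' i := if i == j then t else x i.
  have -> : mev c (fun s => if s \in T then t else x (blk s)) =
      mev c (fun s => x' (blk s)).
    by apply: eq_mev => s; rewrite inE.
  have x'j : x' j = t by rewrite /x' eqxx.
  have x'N i : i != j -> x' i = x i by move=> /negbTE; rewrite /x' => ->.
  have := h x'; rewrite (bigD1 j) //= x'j.
  rewrite (eq_bigr (fun i => x i ^+ k i)) => [|i /x'N -> //].
  rewrite -/Q mulrA [M * _]mulrC mulrAC [_ * M]mulrC [t ^+ _ * _]mulrC mulrA.
  by apply=> i; rewrite /x'; case: eqP.
(* The derivative is at least [M' > 0] at the all-ones point, hence nonzero, as [stable_psum]
   requires. *)
have [S pS] : exists S, psum T c S != 0.
  apply/existsP; rewrite -negb_forall; apply/negP => /forallP p0.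
  have := h' (fun=> 1) (fun=> ltr01).
  rewrite big1 => [|i _]; last by rewrite expr1n.
  rewrite mulr1 /mev big1 => [|S _]; last by rewrite (eqP (p0 S)) mul0r.
  by rewrite leNgt M'0.
have := IH (psum T c) k' M' _ (@nonneg_psum _ _ T c nc) (stable_psum nc sc pS) M'0 h'.
rewrite block_coef_psum // => IH'.
have kj0 : 0 < (k j)%:R :> R by rewrite ltr0n.
rewrite -(ler_pM2l kj0).
have -> : (k j)%:R * (M * \prod_i (poisson_peak (k i) / (k i)`!%:R)) =
    M' * \prod_i (poisson_peak (k' i) / (k' i)`!%:R).
  rewrite (bigD1 j) //= [in RHS](bigD1 j) //= k'j /M'.
  rewrite [in RHS](eq_bigr (fun i => poisson_peak (k i) / (k i)`!%:R)); last first.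
    by move=> i /k'N ->.
  have -> : (k j)`!%:R = (k j)%:R * (k j).-1`!%:R :> R.
    by rewrite -natrM -[in LHS](prednK kj) factS prednK.
  have := poisson_peak_gt0 (k j).-1; have := fact_gt0 (k j).-1.
  rewrite -(ltr0n R) => f0 p0.
  by field; rewrite !gt_eqF.
apply: IH'; rewrite -ltnS; apply: leq_trans kN; rewrite ltnS.
rewrite (bigD1 j) //= [in X in (_ < X)%N](bigD1 j) //= k'j.
rewrite (eq_bigr k) => [|i /k'N //].
by rewrite ltn_add2r prednK.
Qed.

End Coefficient.

(** * Stirling's upper bound for the factorial *)

Section Stirling.
Variable R : realType.
Local Notation e := (expR (1 : R)).

(** The difference of the two sides vanishes at 0 and has derivative
    [t * (expR (- t) - expR t) <= 0]. *)
Lemma expR_pade_le (x : R) : 0 <= x -> (1 - x) * expR x <= (1 + x) * expR (- x).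
Proof.
move=> x0; pose f (t : R) := (1 - t) * expR t - (1 + t) * expR (- t).
pose df (t : R) := t * (expR (- t) - expR t).
have fd (t : R) : is_derive t 1 f (df t).
  by apply: is_derive_eq; rewrite /GRing.scale /= /df; ring.
have [|c cx E] := @MVT_segment R f df 0 x x0 (fun t _ => fd t).
  by apply: derivable_within_continuous => t _; exact: ex_derive.
rewrite -subr_le0 -/(f x); have -> : f x = f x - f 0.
  by rewrite /f oppr0 expR0; ring.
have c0 : 0 <= c by move: cx; rewrite in_itv => /andP [].
rewrite E subr0 mulr_le0_ge0 // mulr_ge0_le0 // subr_le0 ler_expR.
by rewrite (le_trans _ c0) // oppr_le0.
Qed.

(** At [x = 1 / (2 k + 1)] the quotient [(1 + x) / (1 - x)] is [(k + 1) / k], so [expR_pade_le]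
    bounds [expR (2 x)] by it; then raise to the power [2 k + 1]. *)
Lemma expR2_pow_le k : e ^+ 2 * k%:R ^+ (k.*2.+1) <= k.+1%:R ^+ (k.*2.+1) :> R.
Proof.
set N : R := (k.*2.+1)%:R; have N0 : 0 < N by rewrite ltr0n.
have NE : N = 2 * k%:R + 1 by rewrite /N -natr1 -muln2 natrM mulrC.
have k0 : 0 <= k%:R :> R by rewrite ler0n.
have h := @expR_pade_le N^-1; rewrite invr_ge0 (ltW N0) in h.
have {h} : expR (2 / N) * k%:R <= k.+1%:R.
  have {}h := h isT; rewrite -(ler_pM2l (expR_gt0 N^-1)) in h.
  have E1 : expR (2 / N) = expR N^-1 * expR N^-1.
    by rewrite -expRD; congr expR; field; rewrite gt_eqF.
  have E2 : expR N^-1 * ((1 + N^-1) * expR (- N^-1)) = 1 + N^-1.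
    by rewrite mulrCA -expRD subrr expR0 mulr1.
  rewrite E2 mulrCA -E1 in h.
  have N2 : 0 < N / 2 by rewrite divr_gt0.
  rewrite -(ler_pM2l N2) in h; apply: le_trans (le_trans h _).
    rewrite le_eqVlt; apply/orP; left; apply/eqP.
    have -> : N / 2 * ((1 - N^-1) * expR (2 / N)) =
       expR (2 / N) * ((N - 1) / 2) by field; rewrite gt_eqF.
    by rewrite NE; congr (_ * _); field.
  rewrite -natr1 le_eqVlt; apply/orP; left; apply/eqP.
  have -> : N / 2 * (1 + N^-1) = (N + 1) / 2 by field; rewrite gt_eqF.
  by rewrite NE; field.
move=> /(lerXn2r (k.*2.+1)); rewrite !nnegrE mulr_ge0 ?expR_ge0 // ler0n.
move=> /(_ isT isT); rewrite exprMn -[expR (2 / N) ^+ _]expRM_natr -/N divfK ?gt_eqF //.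
by rewrite -[X in expR X]mul1r expRM_natr.
Qed.

(** Stirling's bound [k! <= e * sqrt k * (k / e) ^+ k], squared to avoid the root; it is an equality
    at 1, and [expR2_pow_le] drives the induction. *)
Lemma fact_sqr_le k :
  (k.+1`!%:R) ^+ 2 * e ^+ (k.+1).*2 <= e ^+ 2 * k.+1%:R ^+ (k.+1).*2.+1 :> R.
Proof.
elim: k => [|k IH]; first by rewrite factS fact0 muln1 !expr1n mulr1 mul1r.
have -> : (k.+2`!%:R) ^+ 2 * e ^+ (k.+2).*2 =
    (k.+2%:R ^+ 2 * e ^+ 2) * ((k.+1`!%:R) ^+ 2 * e ^+ (k.+1).*2) :> R.
  by rewrite [k.+2`!]factS natrM doubleS !exprS; ring.
have E0 : 0 <= k.+2%:R ^+ 2 * e ^+ 2 by rewrite mulr_ge0 // exprn_ge0 ?expR_ge0.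
apply: le_trans (ler_wpM2l E0 IH) _.
apply: le_trans (ler_wpM2l E0 (expR2_pow_le k.+1)) _.
by rewrite le_eqVlt; apply/orP; left; apply/eqP; rewrite [in RHS]doubleS !exprS; ring.
Qed.

Lemma stirling_le k : (0 < k)%N ->
  1 / (e * Num.sqrt k%:R) <= poisson_peak R k / k`!%:R.
Proof.
case: k => // k _; set s := Num.sqrt _.
have s0 : 0 < s by rewrite sqrtr_gt0 ltr0n.
have s2 : s ^+ 2 = k.+1%:R by rewrite sqr_sqrtr.
have e0 : 0 < e by exact: expR_gt0.
have f0 : 0 < (k.+1)`!%:R :> R by rewrite ltr0n fact_gt0.
rewrite ler_pdivrMr ?mulr_gt0 // mulrAC ler_pdivlMr // mul1r.
rewrite -(ler_pXn2r (n := 2)) ?nnegrE ?(ltW f0) //; last first.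
  by rewrite !mulr_ge0 ?(ltW e0) ?(ltW s0) ?(ltW (poisson_peak_gt0 _ _)).
have E0 : 0 < e ^+ (k.+1).*2 by rewrite exprn_gt0.
rewrite -(ler_pM2r E0); apply: le_trans (fact_sqr_le k) _.
rewrite le_eqVlt; apply/orP; left; apply/eqP.
rewrite !exprMn s2 /poisson_peak !exprMn !exprVn -!exprM !muln2 [k.+1%:R ^+ _.*2.+1]exprS.
by field; rewrite gt_eqF.
Qed.

End Stirling.

(** * Probabilities and expectations in terms of the generating polynomial *)

Local Open Scope classical_set_scope.
Local Open Scope ring_scope.
Local Open Scope ereal_scope.

Lemma measurable_tuple_bool m (B : set (m.-tuple bool)) : measurable B.
Proof.
have m1 (u : m.-tuple bool) : measurable [set u].
  rewrite (_ : [set u] = \bigcap_(i in [set: 'I_m])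
      ((fun v : m.-tuple bool => tnth v i) @^-1` [set tnth u i])).
    apply: fin_bigcap_measurable => [|i _]; first exact: finite_finset.
    rewrite -[X in measurable X]setTI; exact: measurable_tnth.
  apply/seteqP; split => [v -> //|v h].
  by apply: eq_from_tnth => i; exact: (h i).
rewrite (_ : B = \bigcup_(u in B) [set u]).
  by apply: fin_bigcup_measurable => // ; exact: finite_finset.
by apply/seteqP; split => [v Bv|v [u Bu ->] //]; exists v.
Qed.

Definition tuple_set m (u : m.-tuple bool) : {set 'I_m} := [set i | tnth u i]%SET.

Lemma tuple_setK m : cancel (@tuple_set m) (@indicator_tuple m).
Proof. by move=> u; apply: eq_from_tnth => i; rewrite tnth_mktuple inE. Qed.

Lemma indicator_tupleK m : cancel (@indicator_tuple m) (@tuple_set m).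
Proof. by move=> S; apply/setP => i; rewrite inE tnth_mktuple. Qed.

Section Law.
Variables (R : realType) (m : nat) (mu : probability (m.-tuple bool) R).
Variables (d : measure_display) (T : measurableType d) (P : probability T R).
Variable X : {RV P >-> m.-tuple bool}.
Hypothesis hX : forall B : set (m.-tuple bool), measurable B ->
  distribution P X B = mu B.

(** The coefficients of [gen_poly mu], so that [stable weight] is the strong Rayleigh property. *)
Definition weight (S : {set 'I_m}) : R := fine (mu [set indicator_tuple S]).

Lemma weight_ge0 S : (0 <= weight S)%R.
Proof. by rewrite fine_ge0. Qed.

Lemma measurable_preimage B : measurable (X @^-1` B).
Proof.
by rewrite -[_ @^-1` _]setTI; apply: measurable_funP => //; exact: measurable_tuple_bool.
Qed.

Lemma integral_law (f : {set 'I_m} -> R) : (forall S, (0 <= f S)%R) ->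
  \int[P]_t (f (tuple_set (X t)))%:E = (\sum_S f S * weight S)%:E.
Proof.
move=> f0; pose D S := X @^-1` [set indicator_tuple S].
have mD S : measurable (D S) by exact: measurable_preimage.
have E t : (f (tuple_set (X t)))%:E =
    \sum_(S : {set 'I_m}) (f S)%:E * (\1_(D S) t)%:E.
  rewrite (bigD1 (tuple_set (X t))) //= big1 ?adde0 => [|S St].
    by rewrite indicE mem_set ?mule1 // /D /= tuple_setK.
  rewrite indicE memNset ?mule0 // /D /= => h.
  by move: St; rewrite h indicator_tupleK eqxx.
under eq_integral do rewrite E.
rewrite ge0_integral_sum //.
- rewrite -sumEFin; apply: eq_bigr => S _.
  rewrite ge0_integralZl_EFin //.
  + rewrite integral_indic // setIT EFinM; congr (_ * _).
    rewrite /weight fineK ?fin_num_measure //; last exact: measurable_tuple_bool.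
    by rewrite -hX //; exact: measurable_tuple_bool.
  + by apply/measurable_EFinP; exact: measurable_indic.
- move=> S; apply: measurable_funeM.
  by apply/measurable_EFinP; exact: measurable_indic.
- by move=> S t _; rewrite mule_ge0 ?lee_fin.
Qed.

Lemma probability_law (p : pred {set 'I_m}) :
  P [set t | p (tuple_set (X t))] = (\sum_(S | p S) weight S)%:E.
Proof.
set B := [set t | _].
have mB : measurable B by exact: (measurable_preimage [set u | p (tuple_set u)]).
have := integral_indic P measurableT mB; rewrite setIT => <-.
rewrite big_mkcond /=.
have -> : (\sum_S (if p S then weight S else 0) = \sum_S (p S)%:R * weight S)%R.
  by apply: eq_bigr => S _; case: (p S); rewrite ?mul1r ?mul0r.
rewrite -(integral_law (f := fun S => (p S)%:R%R)) //.
apply: eq_integral => t _; rewrite indicE; congr ((nat_of_bool _)%:R%:E).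
by apply/idP/idP; rewrite inE.
Qed.

Lemma weight_sum1 : mev weight (fun=> 1%R) = 1%R.
Proof.
apply: EFin_inj; rewrite -(probability_setT P).
have -> : [set: T] = [set t | predT (tuple_set (X t))] by apply/seteqP; split.
rewrite probability_law /mev; congr (_%:E); apply: eq_bigr => S _.
by rewrite big1 ?mulr1.
Qed.

Lemma expectation_block n (blk : 'I_m -> 'I_n) i :
'E_P[block_sum R X [set s | blk s == i]%SET] =
  (\sum_(s | blk s == i) mev (pdel s weight) (fun=> 1%R))%:E.
Proof.
pose f (S : {set 'I_m}) : R := (\sum_(s | blk s == i) (s \in S)%:R)%R.
rewrite unlock.
under eq_integral => t _.
  rewrite (_ : block_sum _ _ _ _ = f (tuple_set (X t))); last first.
    by apply: eq_big => [s|s _]; rewrite inE.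
  over.
rewrite integral_law => [|S]; last by rewrite sumr_ge0.
congr (_%:E); rewrite (eq_bigr _ (fun S _ => mulr_suml _ _ _ _)) exchange_big /=.
(* At the all-ones point the [s]-derivative is the total mass minus the mass of the sets avoiding
   [s], that is, the marginal of [s]. *)
apply: eq_bigr => s _; have := mev_split s weight (fun=> 1%R).
rewrite mul1r => /eqP; rewrite addrC -subr_eq => /eqP <-.
rewrite /mev -sumrB; apply: eq_bigr => S _; rewrite big1 // !mulr1 /pres.
by case: (s \in S); rewrite ?mul1r ?mul0r ?subr0 ?subrr.
Qed.

Variables (n : nat) (blk : 'I_m -> 'I_n) (eps : R) (k : 'I_n -> nat).
Hypotheses (hmu : strongly_Rayleigh mu) (heps : (0 < eps)%R).

Let A i := block_sum R X [set s | blk s == i]%SET.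

Lemma block_sumE i t : A i t = (block_count blk (tuple_set (X t)) i)%:R%R.
Proof.
rewrite /A /block_sum /block_count -sum1_card natr_sum big_mkcond [RHS]big_mkcond /=.
apply: eq_bigr => s _; rewrite !inE andbC.
by case: (blk s == i); case: (tnth (X t) s).
Qed.

Lemma probability_block_ge :
  \sum_(i < n) `| 'E_P[A i] - (k i)%:R%:E | <= (1 - eps)%:E ->
  (eps ^+ n * \prod_(i < n | (0 < k i)%N)
     (1 / (expR 1 * Num.sqrt ((k i)%:R : R))))%:E <=
  P [set t | forall i, A i t = (k i)%:R%R].
Proof.
move=> h.
have sw : stable weight by move=> z; exact: hmu.
have nw : nonneg weight by exact: weight_ge0.
have close : (\sum_i `|\sum_(s | blk s == i) mev (pdel s weight) (fun=> 1) - (k i)%:R|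
    <= 1 - eps)%R.
  rewrite -lee_fin -sumEFin; apply: le_trans h.
  rewrite le_eqVlt; apply/orP; left; apply/eqP; apply: eq_bigr => i _.
  by rewrite /A expectation_block.
have cap := capacity_ge nw sw weight_sum1 heps close.
have := block_coef_ge nw sw (exprn_gt0 n heps) cap.
have -> : [set t | forall i, A i t = (k i)%:R%R] =
    [set t | [forall i, block_count blk (tuple_set (X t)) i == k i]].
  apply/seteqP; split => t /= ht.
    apply/forallP => i; have := ht i; rewrite block_sumE => /eqP.
    by rewrite eqr_nat.
  by move=> i; rewrite block_sumE (eqP (forallP ht i)).
rewrite (probability_law (fun S => [forall i, block_count blk S i == k i])).
rewrite lee_fin; apply: le_trans; rewrite ler_wpM2l ?exprn_ge0 ?(ltW heps) //.
(* An index with [k i = 0] contributes the factor 1, which matches the restricted product. *)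
rewrite big_mkcond /=; apply: ler_prod => i _; case: ltnP => ki.
  rewrite stirling_le // divr_ge0 // mulr_ge0 ?expR_ge0 ?sqrtr_ge0 //.
by move: ki; rewrite leqn0 => /eqP ->; rewrite /poisson_peak expr0 divr1 ler01 lexx.
Qed.

End Law.

(** * From indexed partitions to block maps *)

Lemma indexed_partition_fun m n (S : 'I_n -> {set 'I_m}) : indexed_partition S ->
  exists blk : 'I_m -> 'I_n, forall i, S i = [set s | blk s == i]%SET.
Proof.
case=> dS cS; have ex s : exists i, s \in S i.
  have : s \in [set: 'I_m]%SET by rewrite inE.
  by rewrite -cS => /finset.bigcupP [i _ si]; exists i.
have [blk hb] := fin_all_exists ex.
exists blk => i; apply/setP => s; rewrite inE; apply/idP/eqP => [si|<- //].
apply/eqP; apply: contraT => /dS /pred0P /(_ s) /=.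
by rewrite si hb.
Qed.

Theorem theorem2p6 (R : realType) (m n : nat)
    (mu : probability (m.-tuple bool) R) (hmu : strongly_Rayleigh mu)
    (d : measure_display) (T : measurableType d) (P : probability T R)
    (X : {RV P >-> m.-tuple bool})
    (hX : forall B : set (m.-tuple bool), measurable B ->
       distribution P X B = mu B)
    (S : 'I_n -> {set 'I_m}) (hS : indexed_partition S)
    (A : 'I_n -> T -> R) (hA : forall i t, A i t = block_sum R X (S i) t)
    (eps : R) (heps : (0 < eps)%R) :
  (forall kappa : 'I_n -> int,
     (forall i, (0 <= kappa i)%R) ->
     \sum_(i < n) `| 'E_P[A i] - ((kappa i)%:~R)%:E | <= (1 - eps)%:E ->
     P [set t | forall i, A i t = (kappa i)%:~R] >=
       (eps ^+ n *
        \prod_(i < n | (0 < kappa i)%R)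
           (1 / (expR 1 * Num.sqrt ((kappa i)%:~R : R))))%:E)
  /\
  (\sum_(i < n) `| 'E_P[A i] - 1 | <= (1 - eps)%:E ->
   P [set t | forall i, A i t = 1%R] >= ((eps / expR 1) ^+ n)%:E).
Proof.
have [blk hblk] := indexed_partition_fun hS.
have AE : A = fun i => block_sum R X [set s | blk s == i]%SET.
  by apply/funext => i; apply/funext => t; rewrite hA hblk.
have main := @probability_block_ge _ _ _ _ _ _ _ hX _ blk eps _ hmu heps.
split=> [kappa k0 h|h].
  pose k i := absz (kappa i).
  have kE i : kappa i = k i :> int by rewrite /k gez0_abs.
  have := main k; rewrite AE in h *.
  have -> : [set t | forall i, block_sum R X [set s | blk s == i]%SET t = (kappa i)%:~R] =
      [set t | forall i, block_sum R X [set s | blk s == i]%SET t = (k i)%:R%R].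
    by apply/seteqP; split=> t /= ht i; rewrite ht kE.
  under [in X in _ -> X]eq_bigl => i do rewrite kE ltz_nat.
  under [in X in _ -> X]eq_bigr => i _ do rewrite kE.
  by apply; move: h; under eq_bigr => i _ do rewrite kE.
have := main (fun=> 1%N); rewrite AE in h *.
rewrite (eq_bigr (fun=> (expR 1)^-1)%R) => [|i _]; last by rewrite sqrtr1 mulr1 div1r.
by rewrite big_const_ord iter_mulr_1 -exprMn; apply.
Qed.
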